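(* Let $p$ be a prime number, let $X \subset \mathbb{C}_p$ be an analytic space and let $f : X \to \mathbb{C}_p$ be an injective holomorphic function. Then for all distinct $a, b, c, d \in X$, the cross-ratio $R(f(a), f(b); f(c), f(d))$ is well defined and $$|R(a, b; c, d)| = |R(f(a), f(b); f(c), f(d))|.$$
   Context: $\mathbb{C}_p$ is the smallest algebraically closed and complete extension of the field $\mathbb{Q}_p$ of $p$-adic numbers, $|\cdot|$ is its norm, and $|\mathbb{C}_p^*| = \{|z| : z \in \mathbb{C}_p, z \neq 0\}$. For pairwise distinct $a, b, c, d \in \mathbb{C}_p$, the cross-ratio is $$R(a, b; c, d) = \frac{(a-c)(b-d)}{(a-d)(b-c)} \in \mathbb{C}_p^*;$$ it is well defined when the four points are pairwise distinct. A closed (resp. open) ball of $\mathbb{C}_p$ is a set $\{z \in \mathbb{C}_p : |z-a| \le r\}$ (resp. $\{z \in \mathbb{C}_p : |z-a| < r\}$) with $a \in \mathbb{C}_p$ and $r \in |\mathbb{C}_p^*|$. A (closed) affinoid is a set of the form $B - (B_1 \cup \dots \cup B_n)$, where $B$ is a closed ball and $B_1, \dots, B_n$ are open balls. An analytic space (subset of $\mathbb{C}_p$) is an increasing union of affinoids. A holomorphic function on an affinoid is a uniform limit (on the affinoid) of rational functions in $\mathbb{C}_p(z)$ without poles in the affinoid. A holomorphic function on an analytic space $X$ is a function $f: X \to \mathbb{C}_p$ whose restriction to every affinoid contained in $X$ is holomorphic. *)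

(* Defs.v *)
From HB Require Import structures.
From mathcomp Require Import all_boot all_order all_algebra.
From mathcomp Require Import all_classical all_reals.

Set Implicit Arguments.
Unset Strict Implicit.
Unset Printing Implicit Defensive.

Import Order.TTheory GRing.Theory Num.Theory.
Local Open Scope classical_set_scope.
Local Open Scope ring_scope.

(* |m/n|_p = p^(v_p(n) - v_p(m)), and |0|_p = 0 (logn p 0 = 0, hence the test). *)
Definition padic_norm (R : realType) (p : nat) (q : rat) : R :=
  if q == 0 then 0
  else p%:R ^+ logn p `|denq q|%N / p%:R ^+ logn p `|numq q|%N.

Definition cauchy_seq (R : realType) (K : fieldType) (nrm : K -> R)
    (u : nat -> K) : Prop :=
  forall e : R, 0 < e ->
    exists N : nat, forall m n : nat, (N <= m)%N -> (N <= n)%N ->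
      nrm (u m - u n) < e.

Definition converges_to (R : realType) (K : fieldType) (nrm : K -> R)
    (u : nat -> K) (l : K) : Prop :=
  forall e : R, 0 < e ->
    exists N : nat, forall n : nat, (N <= n)%N -> nrm (u n - l) < e.

Definition complete_in (R : realType) (K : fieldType) (nrm : K -> R)
    (F : {pred K}) : Prop :=
  forall u : nat -> K, (forall n, u n \in F) -> cauchy_seq nrm u ->
    exists2 l : K, l \in F & converges_to nrm u l.

Definition alg_closed_in (K : fieldType) (F : {pred K}) : Prop :=
  forall P : {poly K}, P \is a polyOver F -> (1 < size P)%N ->
    exists2 x : K, x \in F & root P x.

(* Q_p inside a complete valued extension K of (rat, |.|_p): the closure of
   rat in K, which is a completion of (rat, |.|_p). *)
Definition Qp_in (R : realType) (K : fieldType) (nrm : K -> R) : set K :=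
  [set x | forall e : R, 0 < e -> exists q : rat, nrm (x - ratr q) < e].

(* (K, nrm) is C_p: a complete, algebraically closed (by its type) valued
   extension of Q_p which is the smallest one, i.e. has no proper subfield that
   contains Q_p, is complete and is algebraically closed.  This determines
   (K, nrm) up to isometric isomorphism. *)
Record is_Cp (R : realType) (p : nat) (K : closedFieldType) (nrm : K -> R) :
    Prop := IsCp {
  Cp_norm_ge0 : forall x : K, 0 <= nrm x;
  Cp_norm_eq0 : forall x : K, nrm x = 0 -> x = 0;
  Cp_normM : forall x y : K, nrm (x * y) = nrm x * nrm y;
  Cp_normD : forall x y : K, nrm (x + y) <= Num.max (nrm x) (nrm y);
  Cp_norm_rat : forall q : rat, nrm (ratr q) = padic_norm R p q;
  Cp_complete : complete_in nrm predT;
  Cp_smallest : forall F : {pred K},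
    divring_closed F -> (forall x : K, Qp_in nrm x -> x \in F) ->
    complete_in nrm F -> alg_closed_in F -> forall x : K, x \in F
}.

(* |K^*| *)
Definition value_group (R : realType) (K : fieldType) (nrm : K -> R) : set R :=
  [set nrm z | z in [set z : K | z != 0]].

Definition is_closed_ball (R : realType) (K : fieldType) (nrm : K -> R)
    (B : set K) : Prop :=
  exists (a : K) (r : R),
    value_group nrm r /\ B = [set z | nrm (z - a) <= r].

Definition is_open_ball (R : realType) (K : fieldType) (nrm : K -> R)
    (B : set K) : Prop :=
  exists (a : K) (r : R),
    value_group nrm r /\ B = [set z | nrm (z - a) < r].

Definition is_affinoid (R : realType) (K : fieldType) (nrm : K -> R)
    (A : set K) : Prop :=
  exists (B : set K) (n : nat) (U : 'I_n -> set K),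
    [/\ is_closed_ball nrm B,
        forall i : 'I_n, is_open_ball nrm (U i) &
        A = B `\` \bigcup_i U i].

(* Sequences lose no generality with respect to increasing or directed families:
   affinoids are open and C_p is separable, so countably many of them suffice. *)
Definition is_analytic_space (R : realType) (K : fieldType) (nrm : K -> R)
    (X : set K) : Prop :=
  exists A : nat -> set K,
    [/\ forall n : nat, is_affinoid nrm (A n),
        forall n : nat, A n `<=` A n.+1 &
        X = \bigcup_n A n].

(* A rational function without poles in A is a quotient P / Q of polynomials
   with Q nowhere zero on A. *)
Definition holomorphic_on_affinoid (R : realType) (K : fieldType)
    (nrm : K -> R) (A : set K) (f : K -> K) : Prop :=
  exists P Q : nat -> {poly K},
    (forall (n : nat) (z : K), A z -> (Q n).[z] != 0) /\
    (forall e : R, 0 < e ->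
       exists N : nat, forall n : nat, (N <= n)%N ->
         forall z : K, A z -> nrm (f z - (P n).[z] / (Q n).[z]) < e).

(* A function X -> K is a total function on K whose values outside X are
   irrelevant. *)
Definition holomorphic_on (R : realType) (K : fieldType) (nrm : K -> R)
    (X : set K) (f : K -> K) : Prop :=
  forall A : set K, is_affinoid nrm A -> A `<=` X ->
    holomorphic_on_affinoid nrm A f.

Definition cross_ratio_defined (K : fieldType) (a b c d : K) : Prop :=
  uniq [:: a; b; c; d].

(* Meaningful when cross_ratio_defined a b c d. *)
Definition cross_ratio (K : fieldType) (a b c d : K) : K :=
  ((a - c) * (b - d)) / ((a - d) * (b - c)).

(* Main.v *)
Require Import Defs.
From HB Require Import structures.
From mathcomp Require Import all_boot all_order all_algebra.
From mathcomp Require Import all_classical all_reals.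
From mathcomp Require Import topology normedtype sequences derive.
From mathcomp Require Import ring lra.

Set Implicit Arguments.
Unset Strict Implicit.
Unset Printing Implicit Defensive.

Import Order.TTheory GRing.Theory Num.Theory.
Import numFieldNormedType.Exports.
Local Open Scope classical_set_scope.
Local Open Scope ring_scope.

(* Let F(x, y) = (f x - f y) / (x - y), extended to the diagonal by f'. Since f
   is injective and the characteristic is 0, F has no zero on A x A for any
   affinoid A in X, so for fixed y the function x |-> |F(x, y)| is of the form
   C |x - e|^m on each annulus of centre e contained in A. Four points a, b, c, d
   satisfy the claim if and only if the ratio |F(a, c)| / |F(a, d)| is unchanged
   when a is replaced by b. If it is not, there is an annulus on the way from a
   to b on which this ratio is not constant, hence two points z, z' of that
   annulus such that v(y) = |F(z, y)| / |F(z', y)| differs at c and d. As F is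
   symmetric, v is in its turn a nontrivial monomial on some annulus on the way
   from c to d and takes a dense set of values there; but z and z' lie in the
   same annulus, so v(y) is an integral power of |z - e| / |z' - e|. *)

(** Off the diagonal F is nonzero by injectivity alone; on the diagonal the claim is that f' has no
    zero. If f' vanished at y but not at some nearby y', then f would scale distances from y' by a
    constant, hence also the larger distances from y, and the monomial law would carry this constant
    back to F(y, y). So f' would vanish on a whole disc and f would be constant on a smaller one:
    passing from f' to f divides coefficients by integers, which costs no more than a factor |p| on
    the radius. The monomial law is obtained without Laurent series. K is algebraically closed, so
    absolute values of rational approximants on circles are read off from their roots. The obstacle
    is that approximants of a zero-free function may have zeros; log-convexity bounds their number,
    and by completeness they would accumulate at a zero of the limit. Radii that are not values of
    the norm are reached by continuity. Centres are always taken in A, so the holes of A spoil only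
    finitely many circles. The way from a to b goes through growing discs around a up to radius |a -
    b|, then through shrinking discs around b. *)

(** * Ultrametric inequalities and norms of integers *)

Section UltrametricNorm.
Variables (R : realType) (p : nat) (K : closedFieldType) (nrm : K -> R).
Hypothesis HK : is_Cp p nrm.

Let normM := Cp_normM HK.
Let norm_ge0 := Cp_norm_ge0 HK.

Lemma nrm1 : nrm 1 = 1.
Proof.
have h : nrm 1 != 0 by apply/eqP => /(Cp_norm_eq0 HK) /eqP; rewrite oner_eq0.
by apply: (mulfI h); rewrite -normM !mulr1.
Qed.

(** Multiplicativity leaves 0 and 1 as possible values; the norm of the rational number 0 excludes
    1. *)
Lemma nrm0 : nrm 0 = 0.
Proof.
have /eqP := normM 0 0; rewrite mulr0 => /eqP h.
have [//|h0] := eqVneq (nrm 0) 0.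
have h1 : nrm 0 = 1 by apply: (mulfI h0); rewrite -h mulr1.
have e0 : ratr 0 = 0 :> K by rewrite -(mulr0n 1) ratr_nat.
have := Cp_norm_rat HK 0; rewrite e0 h1 /padic_norm eqxx => /eqP.
by rewrite oner_eq0.
Qed.

Lemma nrm_eq0 x : (nrm x == 0) = (x == 0).
Proof.
by apply/eqP/eqP => [/(Cp_norm_eq0 HK)//|->]; exact: nrm0.
Qed.

Lemma nrm_gt0 x : (0 < nrm x) = (x != 0).
Proof. by rewrite lt_def nrm_eq0 norm_ge0 andbT. Qed.

Lemma nrmN x : nrm (- x) = nrm x.
Proof.
have h : nrm (-1) = 1.
  apply/eqP; rewrite -(@eqrXn2 _ 2) ?ler01 // expr1n expr2 -normM.
  by rewrite mulrNN mulr1 nrm1.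
by rewrite -mulN1r normM h mul1r.
Qed.

Lemma nrm_distC x y : nrm (x - y) = nrm (y - x).
Proof. by rewrite -nrmN opprB. Qed.

Lemma nrmV x : nrm x^-1 = (nrm x)^-1.
Proof.
have [->|x0] := eqVneq x 0; first by rewrite invr0 nrm0 invr0.
have h : nrm x != 0 by rewrite nrm_eq0.
by apply: (mulfI h); rewrite -normM !divff // nrm1.
Qed.

Lemma nrm_div x y : nrm (x / y) = nrm x / nrm y.
Proof. by rewrite normM nrmV. Qed.

Lemma nrmX x n : nrm (x ^+ n) = nrm x ^+ n.
Proof. by elim: n => [|n IH]; rewrite ?expr0 ?nrm1 // !exprS normM IH. Qed.

Lemma nrm_prod (I : Type) (s : seq I) (F : I -> K) :
  nrm (\prod_(i <- s) F i) = \prod_(i <- s) nrm (F i).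
Proof. by apply: big_morph; [exact: normM|exact: nrm1]. Qed.

Lemma nrmD_le m x y : nrm x <= m -> nrm y <= m -> nrm (x + y) <= m.
Proof.
by move=> hx hy; apply: le_trans (Cp_normD HK x y) _; rewrite ge_max hx hy.
Qed.

Lemma nrmB_le m x y : nrm x <= m -> nrm y <= m -> nrm (x - y) <= m.
Proof. by move=> hx hy; apply: nrmD_le => //; rewrite nrmN. Qed.

Lemma nrmB_lt m x y : nrm x < m -> nrm y < m -> nrm (x - y) < m.
Proof.
move=> hx hy; apply: le_lt_trans (Cp_normD HK x (- y)) _.
by rewrite nrmN gt_max hx hy.
Qed.

Lemma nrm_sum_le m (I : Type) (s : seq I) (F : I -> K) :
  0 <= m -> (forall i, nrm (F i) <= m) -> nrm (\sum_(i <- s) F i) <= m.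
Proof.
move=> m0 h; elim: s => [|i s IH]; first by rewrite big_nil nrm0.
by rewrite big_cons; exact: nrmD_le.
Qed.

Lemma nrm_dist_trans m y x z :
  nrm (x - y) <= m -> nrm (y - z) <= m -> nrm (x - z) <= m.
Proof. by move=> h1 h2; rewrite -(subrKA y); exact: nrmD_le. Qed.

Lemma nrm_dist_lt_trans m y x z :
  nrm (x - y) < m -> nrm (y - z) < m -> nrm (x - z) < m.
Proof.
by move=> h1 h2; rewrite -(subrKA y) -(opprB z y); apply: nrmB_lt; rewrite // nrm_distC.
Qed.

(** The isosceles principle: the two longest sides of an ultrametric triangle are equal. *)
Lemma nrm_dominant x y : nrm (x - y) < nrm y -> nrm x = nrm y.
Proof.
move=> h; apply/le_anti/andP; split.
  by rewrite -(subrK y x); apply: nrmD_le => //; exact: ltW.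
rewrite leNgt; apply/negP => h2.
have : nrm (x - (x - y)) < nrm y by apply: nrmB_lt.
by rewrite opprB addrC subrK ltxx.
Qed.

Lemma nrm_dominantr x y : nrm (x - y) < nrm x -> nrm x = nrm y.
Proof. by rewrite nrm_distC => /nrm_dominant. Qed.

Lemma ler_dist_nrm x y : `|nrm x - nrm y| <= nrm (x - y).
Proof.
have aux u v : nrm u <= nrm (u - v) + nrm v.
  rewrite -{1}(subrK v u); apply: le_trans (Cp_normD HK _ _) _.
  by rewrite ge_max lerDl lerDr !norm_ge0.
rewrite ler_norml; apply/andP; split.
  by have := aux y x; rewrite nrm_distC; lra.
by have := aux x y; lra.
Qed.

(* The two balls of radius r around e and e' coincide. *)
Lemma max_nrm_recenter (r : R) (e e' b : K) : nrm (e - e') <= r ->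
  Num.max r (nrm (b - e)) = Num.max r (nrm (b - e')).
Proof.
move=> h; case: (leP (nrm (b - e)) r) => h1.
  by rewrite (max_l (nrm_dist_trans h1 h)).
have h2 : r < nrm (b - e').
  rewrite ltNge; apply/negP => h2; move: h1; rewrite ltNge => /negP; apply.
  by apply: nrm_dist_trans h2 _; rewrite nrm_distC.
rewrite (max_r (ltW h2)); apply: nrm_dominantr.
by rewrite opprB addrC subrKA; apply: le_lt_trans h1; rewrite nrm_distC.
Qed.

Hypothesis pp : prime p.

Lemma nrm_natr n : (0 < n)%N -> nrm n%:R = (p%:R ^+ logn p n)^-1.
Proof.
move=> n0; have := Cp_norm_rat HK n%:R; rewrite ratr_nat => ->.
rewrite /padic_norm pnatr_eq0 eqn0Ngt n0 /=.
have -> : n%:R = (n%:Z)%:Q :> rat by [].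
by rewrite numq_int denq_int /= logn1 expr0 div1r.
Qed.

Lemma nrm_p : nrm p%:R = p%:R^-1.
Proof. by rewrite nrm_natr ?prime_gt0 // logn_prime // eqxx expr1. Qed.

Lemma nrm_p_gt0 : 0 < nrm p%:R.
Proof. by rewrite nrm_p invr_gt0 ltr0n prime_gt0. Qed.

Lemma nrm_p_lt1 : nrm p%:R < 1.
Proof. by rewrite nrm_p invf_lt1 ?ltr0n ?prime_gt0 // ltr1n prime_gt1. Qed.

(** Since v_p(n + 1) < n + 1, dividing the coefficient of degree n + 1 by n + 1 is compensated by
    shrinking the radius by |p|. *)
Lemma nrm_natr_ge n : nrm p%:R ^+ n.+1 <= nrm (n.+1%:R : K).
Proof.
rewrite nrm_p (nrm_natr (ltn0Sn n)) exprVn lef_pV2 ?posrE ?exprn_gt0 ?ltr0n ?prime_gt0 //.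
apply: ler_weXn2l; first by rewrite ler1n prime_gt0.
by apply: ltnW; exact: ltn_logl.
Qed.

End UltrametricNorm.

(** * Density of the values of the norm *)

Lemma expr_small (R : realType) (t e : R) : 0 <= t -> t < 1 -> 0 < e ->
  exists N, forall n, (N <= n)%N -> t ^+ n < e.
Proof.
move=> t0 t1 e0.
have /cvgrPdist_lt /(_ e e0) [N _ hN] : GRing.exp t @ \oo --> (0 : R).
  by apply: cvg_expr; rewrite ger0_norm.
exists N => n Nn; have := hN n Nn.
by rewrite /= sub0r normrN ger0_norm // exprn_ge0.
Qed.

Section Density.
Variables (R : realType) (p : nat) (K : closedFieldType) (nrm : K -> R).
Hypothesis HK : is_Cp p nrm.
Hypothesis pp : prime p.

(** A root u of X^(N+1) - p has norm below 1 but above x / y, so the powers of its norm form a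
    geometric progression too fine to jump over the interval from x to y. *)
Lemma value_dense (x y : R) : 0 <= x -> x < y ->
  exists z : K, x < nrm z < y.
Proof.
move=> x0 xy; have y0 : 0 < y by exact: le_lt_trans xy.
have xy1 : x / y < 1 by rewrite ltr_pdivrMr // mul1r.
have [N hN] := expr_small (divr_ge0 x0 (ltW y0)) xy1 (nrm_p_gt0 HK pp).
have {hN} := hN N.+1 (leqnSn N).
have /closed_rootP[u] : size ('X^(N.+1) - (p%:R : K)%:P) != 1%N.
  by rewrite size_XnsubC.
rewrite rootE !hornerE subr_eq0 => /eqP hu.
rewrite -hu (nrmX HK) => hc.
have u0 : 0 < nrm u.
  rewrite (nrm_gt0 HK); apply/eqP => u0; have := nrm_p_gt0 HK pp.
  by rewrite -hu u0 expr0n /= (nrm0 HK) ltxx.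
have u1 : nrm u < 1.
  by rewrite -(@expr_lt1 _ N.+1) ?(ltW u0) // -(nrmX HK) hu nrm_p_lt1.
have xu : x < nrm u * y.
  rewrite -ltr_pdivrMr //; rewrite ltNge; apply/negP => h.
  by move: hc; rewrite ltNge => /negP; apply; apply: lerXn2r => //;
     rewrite nnegrE ?(ltW u0) ?divr_ge0 // ltW.
have yV : 0 < y^-1 by rewrite invr_gt0.
(* Dividing by [u ^+ M] makes the progression start above [y], so the first term below [y] has a
   predecessor. *)
have [M hM] := expr_small (ltW u0) u1 yV.
have {}hM := hM M (leqnn M).
have M0 : 0 < nrm u ^+ M by exact: exprn_gt0.
have ex : exists j, nrm u ^+ j < y * nrm u ^+ M.
  have [J hJ] := expr_small (ltW u0) u1 (mulr_gt0 y0 M0).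
  by exists J; exact: hJ.
have [[|j] hj minj] := ex_minnP ex.
  move: hj; rewrite expr0 => hj; have : y * nrm u ^+ M < 1.
    by rewrite -[ltRHS](@mulfV _ y) ?gt_eqF // ltr_pM2l.
  by move=> h; have := lt_trans hj h; rewrite ltxx.
have hj' : y * nrm u ^+ M <= nrm u ^+ j.
  by rewrite leNgt; apply/negP => /minj; rewrite ltnn.
exists (u ^+ j.+1 / u ^+ M); rewrite (nrm_div HK) !(nrmX HK).
rewrite ltr_pdivlMr // ltr_pdivrMr // hj andbT.
rewrite exprS; apply: (lt_le_trans (y := nrm u * (y * nrm u ^+ M))).
  by rewrite mulrA ltr_pM2r.
by rewrite ler_pM2l.
Qed.

Lemma value_dense_avoid (s : seq R) (x y : R) : 0 <= x -> x < y ->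
  exists z : K, x < nrm z < y /\ nrm z \notin s.
Proof.
elim: s x y => [|t s IH] x y x0 xy.
  by have [z hz] := value_dense x0 xy; exists z.
have [/andP[xt ty]|ht] := boolP (x < t < y).
  have [z [/andP[xz zt] zs]] := IH _ _ x0 xt.
  exists z; rewrite xz (lt_trans zt ty) in_cons negb_or zs.
  by rewrite (lt_eqF zt).
have [z [hz zs]] := IH _ _ x0 xy; exists z; split=> //.
rewrite in_cons negb_or zs andbT; apply/eqP => zt.
by move: ht; rewrite -zt hz.
Qed.

(** Relations between radial functions are checked at radii that are norms of points and avoid
    finitely many bad values; this extends them to all radii of the interval, endpoints included. *)
Lemma ge0_dense_radii (s : seq R) (G : R -> R) (x y : R) :
  0 <= x -> x < y -> continuous G ->
  (forall z : K, x < nrm z < y -> nrm z \notin s -> 0 <= G (nrm z)) ->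
  forall t, x <= t <= y -> 0 <= G t.
Proof.
move=> x0 xy cG hG t /andP[xt ty].
rewrite leNgt; apply/negP => Gt0.
have /cvgrPdist_lt /(_ (- G t)) := cG t.
rewrite oppr_gt0 => /(_ Gt0) /nbhs_ballP [d /= d0 hd].
have [z [/andP[h1 h2] zs]] : exists z : K,
    Num.max x (t - d) < nrm z < Num.min y (t + d) /\ nrm z \notin s.
  apply: value_dense_avoid; first by rewrite le_max x0.
  rewrite lt_min !gt_max xy /=; apply/and3P; split; lra.
move: h1 h2; rewrite gt_max lt_min => /andP[h1 h2] /andP[h3 h4].
have hz := hG z (introT andP (conj h1 h3)) zs.
have h5 : ball t d (nrm z).
  by rewrite /ball /= ltr_norml; apply/andP; split; lra.
have := hd _ h5; rewrite /= ltr_norml => /andP[]; lra.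
Qed.

End Density.

(** * Roots of polynomials and Gauss norms *)

Definition poly_roots (K : closedFieldType) (P : {poly K}) : seq K :=
  sval (closed_field_poly_normal P).

Lemma poly_rootsE (K : closedFieldType) (P : {poly K}) :
  P = lead_coef P *: \prod_(b <- poly_roots P) ('X - b%:P).
Proof. exact: svalP (closed_field_poly_normal P). Qed.

Lemma mem_poly_roots (K : closedFieldType) (P : {poly K}) b :
  P != 0 -> (b \in poly_roots P) = root P b.
Proof.
move=> P0; rewrite [in RHS](poly_rootsE P) rootZ ?lead_coef_eq0 //.
by rewrite root_prod_XsubC.
Qed.

(* For rho in the value group this is the maximum of |P| on the closed ball of
   centre e and radius rho. *)
Definition gauss (R : realType) (K : closedFieldType) (nrm : K -> R)
    (P : {poly K}) (e : K) (rho : R) : R :=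
  nrm (lead_coef P) * \prod_(b <- poly_roots P) Num.max rho (nrm (b - e)).

Section GaussNorm.
Variables (R : realType) (p : nat) (K : closedFieldType) (nrm : K -> R).
Hypothesis HK : is_Cp p nrm.
Local Notation gauss := (gauss nrm).

Let norm_ge0 := Cp_norm_ge0 HK.

Lemma nrm_horner P x :
  nrm P.[x] = nrm (lead_coef P) * \prod_(b <- poly_roots P) nrm (b - x).
Proof.
rewrite {1}(poly_rootsE P) hornerZ horner_prod (Cp_normM HK) (nrm_prod HK).
by congr (_ * _); apply: eq_bigr => b _; rewrite !hornerE (nrm_distC HK).
Qed.

Lemma gauss0 P e : gauss P e 0 = nrm P.[e].
Proof.
rewrite nrm_horner; congr (_ * _); apply: eq_bigr => b _.
by rewrite max_r.
Qed.

Lemma gauss_ge0 P e rho : 0 <= gauss P e rho.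
Proof.
by apply: mulr_ge0 => //; apply: prodr_ge0 => b _; rewrite le_max norm_ge0 orbT.
Qed.

Lemma gauss_gt0 (P : {poly K}) e rho : P != 0 -> 0 < rho -> 0 < gauss P e rho.
Proof.
move=> P0 r0; apply: mulr_gt0; first by rewrite (nrm_gt0 HK) lead_coef_eq0.
by apply: prodr_gt0 => b _; rewrite lt_max r0.
Qed.

Lemma gauss_gt0_center (P : {poly K}) e rho : P.[e] != 0 -> 0 < gauss P e rho.
Proof.
move=> Pe; have P0 : P != 0 by apply: contraNneq Pe => ->; rewrite horner0.
apply: mulr_gt0; first by rewrite (nrm_gt0 HK) lead_coef_eq0.
rewrite big_seq; apply: prodr_gt0 => b; rewrite mem_poly_roots // => rb.
rewrite lt_max (nrm_gt0 HK) subr_eq0 orbC; apply/orP; left.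
by apply: contraNneq Pe => <-.
Qed.

Lemma nrm_horner_le_gauss P e rho x :
  nrm (x - e) <= rho -> nrm P.[x] <= gauss P e rho.
Proof.
move=> hx; rewrite nrm_horner; apply: ler_wpM2l => //.
apply: ler_prod => b _; rewrite norm_ge0 /= -(subrKA e).
apply: le_trans (Cp_normD HK _ _) _.
by rewrite ge_max !le_max lexx orbT (nrm_distC HK e) hx.
Qed.

(** In either case x and b lie at different distances from e, so by the isosceles principle |b - x|
    is the larger of the two, which is the factor of b in the Gauss norm. *)
Lemma nrm_horner_gauss P e rho x : nrm (x - e) <= rho ->
  (forall b, b \in poly_roots P -> rho < nrm (b - e) \/
     nrm (x - e) = rho /\ nrm (b - e) < rho) ->
  nrm P.[x] = gauss P e rho.
Proof.
move=> hx hb; rewrite nrm_horner; congr (_ * _).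
rewrite big_seq [RHS]big_seq; apply: eq_bigr => b /hb [h|[h1 h2]].
  rewrite max_r ?(ltW h) //; apply: (nrm_dominant HK).
  by rewrite opprB addrC subrKA (nrm_distC HK); apply: le_lt_trans h.
rewrite max_l ?(ltW h2) // -h1 (nrm_distC HK); apply: (nrm_dominant HK).
have -> : b - x - (e - x) = b - e by ring.
by rewrite (nrm_distC HK e) h1.
Qed.

Lemma gauss_recenter P e e' rho :
  nrm (e - e') <= rho -> gauss P e rho = gauss P e' rho.
Proof.
move=> h; congr (_ * _); apply: eq_bigr => b _.
exact: (max_nrm_recenter HK).
Qed.

Lemma continuous_gauss P e : continuous (gauss P e).
Proof.
move=> x; apply: (@continuousM _ _ (fun _ => nrm (lead_coef P))
  (fun rho => \prod_(b <- poly_roots P) Num.max rho (nrm (b - e)))).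
  exact: cvg_cst.
elim: (poly_roots P) => [|b s IH].
  rewrite (_ : (fun _ => _) = fun _ => 1); first exact: cvg_cst.
  by apply/funext => rho; rewrite big_nil.
rewrite (_ : (fun _ => _) = fun rho => Num.max rho (nrm (b - e)) *
  \prod_(b <- s) Num.max rho (nrm (b - e))).
  apply: continuousM IH; apply: (@continuous_max _ _ id (fun _ => nrm (b - e))).
    exact: cvg_id.
  exact: cvg_cst.
by apply/funext => rho; rewrite big_cons.
Qed.

(** In logarithmic coordinates the Gauss norm is convex and piecewise affine, with breaks at the
    distances of the roots. Each root at a distance between s1 and s2 contributes a full factor s1 /
    t1 to the convexity defect; this later turns bounds on Gauss norms into a bound on the number of
    roots. *)
Lemma gauss_logconvex P e (t1 s1 s2 t2 : R) :
  0 < t1 -> t1 <= s1 -> s1 <= s2 -> s2 <= t2 -> t1 * t2 = s1 * s2 ->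
  (s1 / t1) ^+ count (fun b => s1 <= nrm (b - e) <= s2) (poly_roots P)
    * (gauss P e s1 * gauss P e s2) <= gauss P e t1 * gauss P e t2.
Proof.
move=> t10 t1s s12 s2t ts; rewrite /gauss.
set c0 := nrm (lead_coef P).
set A := \prod_(b <- _) Num.max s1 _; set B := \prod_(b <- _) Num.max s2 _.
set C := \prod_(b <- _) Num.max t1 _; set D := \prod_(b <- _) Num.max t2 _.
set T := (s1 / t1) ^+ _.
suff h : T * (A * B) <= C * D.
  rewrite [leLHS](_ : _ = c0 * c0 * (T * (A * B))); last by ring.
  rewrite [leRHS](_ : _ = c0 * c0 * (C * D)); last by ring.
  by apply: ler_wpM2l h; apply: mulr_ge0; exact: norm_ge0.
rewrite {}/T {}/A {}/B {}/C {}/D.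
have st : 1 <= s1 / t1 by rewrite ler_pdivlMr ?mul1r.
have stE : s1 / t1 * s2 = t2.
  by apply: (mulfI (x := t1)); rewrite ?gt_eqF // mulrCA mulrA;
     rewrite divfK ?gt_eqF // mulrC ts mulrC.
elim: (poly_roots P) => [|b s IH] /=; first by rewrite !big_nil expr0 !mulr1.
rewrite !big_cons exprD.
set A := \prod_(i <- s) Num.max s1 _; set B := \prod_(i <- s) Num.max s2 _.
rewrite (mulrACA _ A) (mulrACA _ _ (_ * _) (A * B)) [leRHS]mulrACA.
apply: ler_pM => //.
- by rewrite !mulr_ge0 ?exprn_ge0 ?le_max ?norm_ge0 ?orbT //; lra.
- by rewrite !mulr_ge0 ?exprn_ge0 ?prodr_ge0 // => *;
    rewrite ?le_max ?norm_ge0 ?orbT //; lra.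
- set c := nrm (b - e).
  have hc0 : 0 <= c := norm_ge0 _.
  case: (boolP (s1 <= c <= s2)) => [/andP[h1 h2]|hc].
    rewrite expr1 (max_r h1) (max_l h2) (max_l (le_trans h2 s2t)).
    rewrite (max_r (le_trans t1s h1)) mulrCA stE //.
  rewrite expr0 mul1r.
  move: hc; rewrite negb_and -!ltNge => /orP[hc|hc].
    rewrite (max_l (ltW hc)) (max_l (ltW (lt_le_trans hc s12))).
    rewrite (max_l (y := c) (x := t2)); last by lra.
    by case: (leP t1 c) => h; nra.
  rewrite (max_r (ltW hc)) (max_r (ltW (le_lt_trans s12 hc))).
  rewrite (max_r (x := t1)); last by lra.
  by rewrite ler_wpM2l // le_max lexx orbT.
Qed.

Lemma gauss_logaffine P e (t1 s1 s2 t2 : R) :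
  0 < t1 -> t1 <= s1 -> s1 <= s2 -> s2 <= t2 -> t1 * t2 = s1 * s2 ->
  (forall b, b \in poly_roots P -> ~~ (t1 < nrm (b - e) < t2)) ->
  gauss P e t1 * gauss P e t2 = gauss P e s1 * gauss P e s2.
Proof.
move=> t10 t1s s12 s2t ts hb; rewrite /gauss mulrACA [RHS]mulrACA.
congr (_ * _); rewrite -!big_split /= big_seq [RHS]big_seq.
apply: eq_bigr => b /hb; rewrite negb_and -!leNgt => /orP[h|h].
  by rewrite !max_l //; lra.
by rewrite !max_r //; lra.
Qed.

Lemma gauss_monomial (P : {poly K}) e (s1 s2 : R) :
  P != 0 -> 0 < s1 -> s1 <= s2 ->
  (forall b, b \in poly_roots P -> ~~ (s1 <= nrm (b - e) <= s2)) ->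
  exists (C : R) (n : nat), 0 < C /\
    forall rho, s1 <= rho <= s2 -> gauss P e rho = C * rho ^+ n.
Proof.
move=> P0 s10 s12 hb; rewrite /gauss.
have : 0 < nrm (lead_coef P) by rewrite (nrm_gt0 HK) lead_coef_eq0.
elim: (poly_roots P) hb (nrm _) => [|b s IH] hb c c0.
  by exists c, 0%N; split=> // rho _; rewrite big_nil expr0.
have {}IH := IH (fun b' h => hb b' (mem_behead (s := b :: s) h)).
have := hb b (mem_head _ _); rewrite negb_and -!ltNge => /orP[h|h].
  have [C [n [C0 hC]]] := IH c c0.
  exists C, n.+1; split=> // rho /andP[hr1 hr2]; rewrite big_cons max_l; last by lra.
  by rewrite mulrCA hC ?hr1 // exprS mulrCA.
have [|C [n [C0 hC]]] := IH (c * nrm (b - e)).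
  by apply: mulr_gt0 => //; lra.
exists C, n; split=> // rho /andP[hr1 hr2]; rewrite big_cons max_r; last by lra.
by rewrite mulrA hC ?hr1.
Qed.

End GaussNorm.

(** * Radial norms as limits of Gauss norms *)

(* (P n / Q n) is a sequence of rational functions without poles in A that
   converges uniformly on A to k. *)
Definition uniform_approx (R : realType) (K : fieldType) (nrm : K -> R)
    (A : set K) (k : K -> K) (P Q : nat -> {poly K}) : Prop :=
  (forall (n : nat) (z : K), A z -> (Q n).[z] != 0) /\
  (forall e : R, 0 < e ->
     exists N : nat, forall n : nat, (N <= n)%N ->
       forall z : K, A z -> nrm (k z - (P n).[z] / (Q n).[z]) < e).

(* A contains the circles of centre e and of radius at most r, except those
   whose radius is in the finite list S. *)
Definition radial_domain (R : realType) (K : fieldType) (nrm : K -> R)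
    (A : set K) (e : K) (r : R) (S : seq R) : Prop :=
  [/\ A e, 0 < r &
      forall x, nrm (x - e) <= r -> nrm (x - e) \notin S -> A x].

Definition gap (R : realType) (S : seq R) (x y : R) : Prop :=
  forall s, s \in S -> ~~ (x < s < y).

(* Functions of a radius in [0, r] are extended to R by composition with clamp,
   so that their continuity can be stated globally. *)
Definition clamp (R : realType) (r rho : R) : R := Num.max 0 (Num.min r rho).

Lemma continuous_clamp (R : realType) (r : R) : continuous (clamp r).
Proof.
move=> x; apply: (@continuous_max _ _ (fun _ => 0) (Num.min r)).
  exact: cvg_cst.
apply: (@continuous_min _ _ (fun _ => r) id); first exact: cvg_cst.
exact: cvg_id.
Qed.

Lemma clamp_id (R : realType) (r rho : R) : 0 <= rho <= r -> clamp r rho = rho.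
Proof. by move=> /andP[h1 h2]; rewrite /clamp min_r // max_r. Qed.

Lemma clamp_itv (R : realType) (r rho : R) : 0 < r -> 0 <= clamp r rho <= r.
Proof.
by move=> r0; rewrite /clamp le_max lexx ge_max (ltW r0) ge_min lexx.
Qed.

Lemma clampK (R : realType) (r rho : R) :
  0 < r -> clamp r (clamp r rho) = clamp r rho.
Proof. by move=> r0; rewrite clamp_id // clamp_itv. Qed.

Definition gauss_quot (R : realType) (K : closedFieldType) (nrm : K -> R)
    (P Q : nat -> {poly K}) (e : K) (r : R) (n : nat) (rho : R) : R :=
  gauss nrm (P n) e (clamp r rho) / gauss nrm (Q n) e (clamp r rho).

(* The value of |k| on the circle of centre e and radius rho is at most this
   limit, with equality on circles near which k has no zero. *)
Definition radial_norm (R : realType) (K : closedFieldType) (nrm : K -> R)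
    (P Q : nat -> {poly K}) (e : K) (r : R) (rho : R) : R :=
  lim ((gauss_quot nrm P Q e r ^~ rho) @ \oo).

Section RadialNorm.
Variables (R : realType) (p : nat) (K : closedFieldType) (nrm : K -> R).
Hypothesis HK : is_Cp p nrm.
Hypothesis pp : prime p.
Variables (A : set K) (k : K -> K) (P Q : nat -> {poly K}).
Hypothesis kPQ : uniform_approx nrm A k P Q.
Variables (e : K) (r : R) (S : seq R).
Hypothesis Aer : radial_domain nrm A e r S.

Local Notation g := (gauss_quot nrm P Q e r).
Local Notation H := (radial_norm nrm P Q e r).
Local Notation q n z := ((P n).[z] / (Q n).[z]).

Let Ae : A e. Proof. by case: Aer. Qed.
Let r0 : 0 < r. Proof. by case: Aer. Qed.
Let norm_ge0 := Cp_norm_ge0 HK.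

Lemma gauss_den_gt0 n rho : 0 < gauss nrm (Q n) e rho.
Proof. by apply: (gauss_gt0_center HK); case: kPQ => + _; apply. Qed.

Lemma gauss_quot_ge0 n rho : 0 <= g n rho.
Proof. by rewrite divr_ge0 // (gauss_ge0 HK). Qed.

Lemma continuous_gauss_quot n : continuous (g n).
Proof.
move=> x; apply: (@continuousM _ _
  (fun rho => gauss nrm (P n) e (clamp r rho))
  (fun rho => (gauss nrm (Q n) e (clamp r rho))^-1)).
  apply: (@continuous_comp _ _ _ (clamp r) (gauss nrm (P n) e)).
    exact: continuous_clamp.
  exact: continuous_gauss.
apply: (@continuousV _ _ (fun rho => gauss nrm (Q n) e (clamp r rho))).
  by rewrite gt_eqF // gauss_den_gt0.
apply: (@continuous_comp _ _ _ (clamp r) (gauss nrm (Q n) e)).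
  exact: continuous_clamp.
exact: continuous_gauss.
Qed.

(** Denominators have no zero in A, which contains all other circles of the disc. The same finite
    set of radii thus serves for every n. *)
Lemma den_root_radius n b : b \in poly_roots (Q n) ->
  nrm (b - e) <= r -> nrm (b - e) \in S.
Proof.
move=> hb hr; have Q0 : Q n != 0.
  by case: kPQ => /(_ n e Ae) + _; apply: contraNneq => ->; rewrite horner0.
move: hb; rewrite mem_poly_roots // rootE => hb.
apply: contraT => hS; have Ab : A b by case: Aer => _ _; apply.
by case: kPQ => /(_ n b Ab); rewrite hb.
Qed.

Lemma nrm_den n z : nrm (z - e) <= r -> nrm (z - e) \notin S ->
  nrm (Q n).[z] = gauss nrm (Q n) e (nrm (z - e)).
Proof.
move=> hr hS; apply: (nrm_horner_gauss HK) => // b hb.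
case: (ltgtP (nrm (z - e)) (nrm (b - e))) => h; [by left|by right|].
by move: hS; rewrite h (den_root_radius hb) // -h.
Qed.

Lemma nrm_quot_le n z : nrm (z - e) <= r -> nrm (z - e) \notin S ->
  nrm (q n z) <= g n (nrm (z - e)).
Proof.
move=> hr hS; rewrite (nrm_div HK) nrm_den // /gauss_quot clamp_id ?norm_ge0 //.
rewrite ler_pM2r ?invr_gt0 ?gauss_den_gt0 //.
exact: (nrm_horner_le_gauss HK).
Qed.

Lemma nrm_quot n z : nrm (z - e) <= r -> nrm (z - e) \notin S ->
  (forall b, b \in poly_roots (P n) -> nrm (b - e) != nrm (z - e)) ->
  nrm (q n z) = g n (nrm (z - e)).
Proof.
move=> hr hS hP; rewrite (nrm_div HK) nrm_den // /gauss_quot clamp_id ?norm_ge0 //.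
congr (_ / _); apply: (nrm_horner_gauss HK) => // b hb.
case: (ltgtP (nrm (z - e)) (nrm (b - e))) => h; [by left|by right|].
by move: (hP b hb); rewrite h eqxx.
Qed.

(** Away from the finite set [T] of radii of holes and of zeros, both Gauss quotients are norms of
    values at one point of A, where the hypothesis applies; the other radii follow by density and
    continuity. *)
Lemma gauss_quot_cauchy (eps : R) n m :
  (forall z, A z -> nrm (q n z - q m z) <= eps) ->
  forall rho, `|g n rho - g m rho| <= eps.
Proof.
move=> hnm rho.
pose T := S ++ [seq nrm (b - e) | b <- poly_roots (P n)]
  ++ [seq nrm (b - e) | b <- poly_roots (P m)].
pose G t := eps - `|g n t - g m t|.
have cG : continuous G.
  move=> x; suff : (fun t => eps - `|g n t - g m t|) @ x --> eps - `|g n x - g m x| by [].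
  apply: cvgB; first exact: cvg_cst.
  by apply: cvg_norm; apply: cvgB; exact: continuous_gauss_quot.
have main : forall z : K, 0 < nrm z < r -> nrm z \notin T -> 0 <= G (nrm z).
  move=> z /andP[z0 zr]; rewrite !mem_cat !negb_or => /and3P[zS zn zm].
  have ez : nrm (z + e - e) = nrm z by rewrite addrK.
  have zr' := ltW zr.
  rewrite /G subr_ge0 -ez -!nrm_quot ?ez //.
  - apply: le_trans (ler_dist_nrm HK _ _) (hnm _ _).
    by case: Aer => _ _; apply; rewrite ez.
  - by move=> b hb; apply: contraNneq zm => <-; apply/mapP; exists b.
  - by move=> b hb; apply: contraNneq zn => <-; apply/mapP; exists b.
have := ge0_dense_radii HK pp (lexx 0) r0 cG main (clamp_itv rho r0).
by rewrite /G subr_ge0 /gauss_quot clampK.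
Qed.

Lemma gauss_quot_cauchy_unif (eps : R) : 0 < eps -> exists N,
  forall n m, (N <= n)%N -> (N <= m)%N ->
  forall rho, `|g n rho - g m rho| <= eps.
Proof.
move=> e0; case: kPQ => _ /(_ _ e0) [N hN]; exists N => n m hn hm.
apply: gauss_quot_cauchy => z Az.
apply: (nrm_dist_trans HK (y := k z)); last exact: ltW (hN _ hm _ Az).
by rewrite (nrm_distC HK); exact: ltW (hN _ hn _ Az).
Qed.

Lemma cvg_radial_norm rho : (g ^~ rho) @ \oo --> H rho.
Proof.
apply/cvg_ex.
suff : cvg ((g ^~ rho) @ \oo) by move=> /cvg_ex.
apply/cauchy_cvgP; apply: cauchy_exP => eps e0.
have [N hN] := gauss_quot_cauchy_unif (divr_gt0 e0 (ltr0n R 2)).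
exists (g N rho), N => // n /= Nn; rewrite /ball /=.
apply: le_lt_trans (hN _ _ (leqnn N) Nn rho) _; lra.
Qed.

Lemma unif_radial_norm (eps : R) : 0 < eps -> exists N,
  forall n, (N <= n)%N -> forall rho, `|g n rho - H rho| <= eps.
Proof.
move=> e0; have [N hN] := gauss_quot_cauchy_unif e0; exists N => n hn rho.
have h : (fun m => `|g n rho - g m rho|) @ \oo --> `|g n rho - H rho|.
  by apply: cvg_norm; apply: cvgB; [exact: cvg_cst|exact: cvg_radial_norm].
apply: (closed_cvg (fun x => x <= eps) _ _ _ h); first exact: closed_le.
by exists N => // m Nm; exact: hN.
Qed.

Lemma continuous_radial_norm : continuous H.
Proof.
move=> x; apply/cvgrPdist_lt => eps e0.
have e3 : 0 < eps / 4 by lra.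
have [N hN] := unif_radial_norm e3.
have /cvgrPdist_lt /(_ _ e3) := @continuous_gauss_quot N x.
apply: filterS => t ht.
have h1 := hN N (leqnn N) x; have h2 := hN N (leqnn N) t.
have -> : H x - H t = - (g N x - H x) + (g N x - g N t) + (g N t - H t) by ring.
apply: le_lt_trans (ler_normD _ _) _.
apply: (@le_lt_trans _ _ (`|g N x - H x| + `|g N x - g N t| + `|g N t - H t|)).
  by rewrite lerD2r -(normrN (g N x - H x)); exact: ler_normD.
lra.
Qed.

Lemma radial_norm_ge0 rho : 0 <= H rho.
Proof.
apply: (@ler_cvg_to _ \oo _ _ (fun _ => 0) (g ^~ rho)).
- exact: cvg_cst.
- exact: cvg_radial_norm.
by near=> n; exact: gauss_quot_ge0.
Unshelve. all: by end_near. Qed.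

Lemma radial_norm_clamp rho : H (clamp r rho) = H rho.
Proof.
rewrite /radial_norm (_ : g ^~ (clamp r rho) = g ^~ rho) //; apply/funext => n.
by rewrite /gauss_quot clampK.
Qed.

Lemma cvg_nrm_quot z : A z -> (fun n => nrm (q n z)) @ \oo --> nrm (k z).
Proof.
move=> Az; apply/cvgrPdist_lt => eps e0.
case: kPQ => _ /(_ _ e0) [N hN]; exists N => // n /= Nn.
by apply: le_lt_trans (ler_dist_nrm HK _ _) _; exact: hN.
Qed.

Lemma nrm_le_radial_norm z : nrm (z - e) <= r -> nrm (z - e) \notin S ->
  nrm (k z) <= H (nrm (z - e)).
Proof.
move=> hr hS; have Az : A z by case: Aer => _ _; apply.
apply: (@ler_cvg_to _ \oo _ _ (fun n => nrm (q n z)) (g ^~ (nrm (z - e)))).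
- exact: cvg_nrm_quot.
- exact: cvg_radial_norm.
by near=> n; exact: nrm_quot_le.
Unshelve. all: by end_near. Qed.

Lemma radial_norm_center : H 0 = nrm (k e).
Proof.
have h : (g ^~ 0) @ \oo --> nrm (k e).
  rewrite (_ : g ^~ 0 = fun n => nrm (q n e)); first exact: cvg_nrm_quot.
  apply/funext => n; rewrite (nrm_div HK) /gauss_quot.
  by rewrite clamp_id ?lexx ?ltW // !(gauss0 HK).
by rewrite -(cvg_lim _ h).
Qed.

End RadialNorm.

(** At radius r the discs around a and b coincide: here a path of discs growing from a can be
    continued by one shrinking to b. *)
Lemma radial_norm_recenter (R : realType) (p : nat) (K : closedFieldType)
    (nrm : K -> R) (P Q : nat -> {poly K}) (a b : K) (r : R) :
  is_Cp p nrm -> 0 < r -> nrm (a - b) <= r ->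
  radial_norm nrm P Q a r r = radial_norm nrm P Q b r r.
Proof.
move=> HK r0 hab; rewrite /radial_norm.
rewrite (_ : gauss_quot nrm P Q a r ^~ r = gauss_quot nrm P Q b r ^~ r) //.
apply/funext => n; rewrite /gauss_quot clamp_id ?lexx ?ltW //.
by rewrite !(gauss_recenter HK _ hab).
Qed.

(** * Zeros of the approximants in an annulus *)

Section Roots.
Variables (R : realType) (p : nat) (K : closedFieldType) (nrm : K -> R).
Hypothesis HK : is_Cp p nrm.
Let norm_ge0 := Cp_norm_ge0 HK.

(** Only the roots in the annulus can make |P(b)| smaller than the Gauss norm, each by a factor at
    least t / s2. Conversely, once the number of these roots is bounded, a very small value at b
    forces a root near b. *)
Lemma nrm_horner_away_roots (P : {poly K}) (e b : K) (s1 s2 t : R) :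
  0 < t -> t <= s2 -> s1 <= nrm (b - e) <= s2 ->
  (forall c, c \in poly_roots P -> t <= nrm (c - b)) ->
  (t / s2) ^+ count (fun c => s1 <= nrm (c - e) <= s2) (poly_roots P)
    * gauss nrm P e (nrm (b - e)) <= nrm P.[b].
Proof.
move=> t0 ts /andP[b1 b2] hc; rewrite (nrm_horner HK) /gauss mulrCA.
apply: ler_wpM2l => //.
have ts0 : 0 <= t / s2 by rewrite divr_ge0 //; lra.
elim: (poly_roots P) hc => [|c s IH] hc /=; first by rewrite !big_nil expr0 mulr1.
rewrite !big_cons exprD mulrACA; apply: ler_pM.
- by rewrite mulr_ge0 ?exprn_ge0 // le_max norm_ge0.
- by rewrite mulr_ge0 ?exprn_ge0 // prodr_ge0 // => i _; rewrite le_max norm_ge0.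
- case: (boolP (s1 <= nrm (c - e) <= s2)) => [/andP[c1 c2]|hcs].
    rewrite expr1; apply: le_trans (hc c (mem_head _ _)).
    apply: (@le_trans _ _ (t / s2 * s2)); last by rewrite divfK // gt_eqF //; lra.
    by rewrite ler_wpM2l // ge_max b2.
  rewrite expr0 mul1r.
  have hne : nrm (c - e) != nrm (b - e).
    by apply: contraNneq hcs => ->; rewrite b1.
  case: (ltgtP (nrm (b - e)) (nrm (c - e))) hne => // h _.
    rewrite le_eqVlt; apply/orP; left; apply/eqP/esym/(nrm_dominant HK).
    have -> : c - b - (c - e) = - (b - e) by ring.
    by rewrite (nrmN HK).
  rewrite le_eqVlt; apply/orP; left; apply/eqP/esym.
  rewrite (nrm_distC HK c b); apply: (nrm_dominant HK).
  have -> : b - c - (b - e) = - (c - e) by ring.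
  by rewrite (nrmN HK).
- by apply: IH => d hd; apply: hc; rewrite in_cons hd orbT.
Qed.

(** In the product for P(l) the root b gives |b - l|, against a factor at least |l - e| in the Gauss
    norm, which dominates the remaining factors. Roots approaching l therefore force the values at l
    to tend to 0. *)
Lemma nrm_horner_near_root (P : {poly K}) (e b l : K) : b \in poly_roots P ->
  nrm P.[l] * nrm (l - e) <= gauss nrm P e (nrm (l - e)) * nrm (b - l).
Proof.
move=> hb; rewrite (nrm_horner HK) /gauss (big_rem b hb).
rewrite (big_rem b hb (F := fun c => Num.max _ _)) /=.
set L := nrm (lead_coef P); set D := nrm (b - l); set N := nrm (l - e).
set B1 := \prod_(_ <- _) _; set B2 := \prod_(_ <- _) _.
have hB : B1 <= B2.
  apply: ler_prod => c _; rewrite norm_ge0 /= -(subrKA e).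
  apply: le_trans (Cp_normD HK _ _) _.
  by rewrite (nrm_distC HK e l) maxC.
have B10 : 0 <= B1 by apply: prodr_ge0.
rewrite [leLHS](_ : _ = L * D * (B1 * N)); last by ring.
rewrite [leRHS](_ : _ = L * D * (B2 * Num.max N (nrm (b - e)))); last by ring.
apply: ler_wpM2l; first by rewrite mulr_ge0 // norm_ge0.
by apply: ler_pM => //; [exact: norm_ge0|rewrite le_max lexx].
Qed.

End Roots.

Section Annulus.
Variables (R : realType) (p : nat) (K : closedFieldType) (nrm : K -> R).
Hypothesis HK : is_Cp p nrm.
Hypothesis pp : prime p.
Variables (A : set K) (k : K -> K) (P Q : nat -> {poly K}).
Hypothesis kPQ : uniform_approx nrm A k P Q.
Variables (e : K) (r : R) (S : seq R).
Hypothesis Aer : radial_domain nrm A e r S.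
Variables (x y : R).
Hypotheses (x0 : 0 <= x) (yr : y <= r) (Sxy : gap S x y).
Hypothesis knz : forall z, x < nrm (z - e) < y -> k z != 0.

Local Notation g := (gauss_quot nrm P Q e r).
Local Notation H := (radial_norm nrm P Q e r).
Local Notation q n z := ((P n).[z] / (Q n).[z]).
Local Notation nroots s1 s2 n :=
  (count (fun b => s1 <= nrm (b - e) <= s2) (poly_roots (P n))).

Let Ae : A e. Proof. by case: Aer. Qed.
Let r0 : 0 < r. Proof. by case: Aer. Qed.
Let norm_ge0 := Cp_norm_ge0 HK.

Lemma gap_radius rho : x < rho < y -> rho <= r /\ rho \notin S.
Proof.
move=> h; split; first by case/andP: h => _ h; apply: le_trans yr; exact: ltW.
by apply/negP => /Sxy; rewrite h.
Qed.

Lemma annulus_domain z : x < nrm (z - e) < y -> A z.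
Proof. by move=> /gap_radius[h1 h2]; case: Aer => _ _; apply. Qed.

Lemma den_root_annulus n b :
  b \in poly_roots (Q n) -> ~~ (x < nrm (b - e) < y).
Proof.
move=> hb; apply/negP => /gap_radius[h1]; rewrite (den_root_radius kPQ Aer hb) //.
Qed.

(** The denominators have no root in the annulus, so their Gauss norms are log-affine there and
    cancel: only zeros of the numerator count. *)
Lemma gauss_quot_logconvex n (t1 s1 s2 t2 : R) :
  x < t1 -> t1 <= s1 -> s1 <= s2 -> s2 <= t2 -> t2 < y -> t1 * t2 = s1 * s2 ->
  (s1 / t1) ^+ nroots s1 s2 n * (g n s1 * g n s2) <= g n t1 * g n t2.
Proof.
move=> xt ts1 s12 st2 ty ts; rewrite /gauss_quot.
have t10 : 0 < t1 by exact: le_lt_trans xt.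
have yr' := yr; rewrite !clamp_id; try by apply/andP; split; lra.
have QE : gauss nrm (Q n) e t1 * gauss nrm (Q n) e t2 =
          gauss nrm (Q n) e s1 * gauss nrm (Q n) e s2.
  apply: gauss_logaffine => // b hb.
  apply: contra (den_root_annulus hb) => /andP[h1 h2].
  by rewrite (lt_trans xt h1) (lt_trans h2 ty).
rewrite !mulf_div mulrA QE ler_pM2r ?(gauss_logconvex HK) //.
by rewrite invr_gt0 mulr_gt0 // (gauss_den_gt0 HK kPQ Aer).
Qed.

Lemma radial_norm_value_gt0 z : x < nrm (z - e) < y -> 0 < H (nrm (z - e)).
Proof.
move=> hz; have [h1 h2] := gap_radius hz.
apply: lt_le_trans (nrm_le_radial_norm HK pp kPQ Aer h1 h2).
by rewrite (nrm_gt0 HK) knz.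
Qed.

(** At the norm s of a point, H bounds a nonzero value of k. If rho is not such a norm, take s
    slightly larger and reflect: with rho * t = s^2, log-convexity gives H(s)^2 <= H(rho) H(t), so
    H(rho) cannot be 0. *)
Lemma radial_norm_gt0 rho : x < rho < y -> 0 < H rho.
Proof.
move=> /andP[xr ry]; have rho0 : 0 < rho by exact: le_lt_trans xr.
have y0 : 0 < y by exact: lt_trans ry.
(* Taking [s] below the geometric mean of [rho] and [y] keeps the reflected radius [t] below [y]. *)
set u := Num.sqrt (rho * y).
have u0 : 0 <= u by exact: sqrtr_ge0.
have uE : u ^+ 2 = rho * y by rewrite sqr_sqrtr // mulr_ge0 // ltW.
have ru : rho < u by rewrite ltNge; apply/negP => h; nra.
have [z /andP[hz1 hz2]] := value_dense HK pp (ltW rho0) ru.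
set s := nrm z in hz1 hz2.
have s0 : 0 < s by exact: lt_trans hz1.
have ssy : s * s < rho * y by nra.
have uy : u < y by rewrite ltNge; apply/negP => h; nra.
pose t := s * s / rho.
have tE : rho * t = s * s by rewrite mulrC divfK // gt_eqF.
have st : s <= t by rewrite ler_pdivlMr // ler_pM2l // ltW.
have ty : t < y by rewrite ltr_pdivrMr // (mulrC y).
have ez : nrm (z + e - e) = s by rewrite addrK.
have Hs : 0 < H s.
  rewrite -ez; apply: radial_norm_value_gt0.
  by rewrite ez (lt_trans xr hz1) (lt_trans hz2 uy).
have le2 n : g n s * g n s <= g n rho * g n t.
  apply: le_trans (gauss_quot_logconvex n xr (ltW hz1) (lexx s) st ty tE).
  apply: ler_peMl; first by rewrite mulr_ge0 // (gauss_quot_ge0 HK).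
  by apply: exprn_ege1; rewrite ler_pdivlMr // mul1r ltW.
have cg := cvg_radial_norm HK pp kPQ Aer.
have : H s * H s <= H rho * H t.
  apply: (@ler_cvg_to _ \oo _ _ (fun n => g n s * g n s) (fun n => g n rho * g n t)).
  - exact: cvgM.
  - exact: cvgM.
  - by near=> n; exact: le2.
have := radial_norm_ge0 HK pp kPQ Aer rho.
rewrite le_eqVlt => /orP[/eqP <-|//]; rewrite mul0r => h.
have := mulr_gt0 Hs Hs; lra.
Unshelve. all: by end_near. Qed.

Lemma gauss_quot_bounds (s1 s2 : R) : x < s1 -> s1 <= s2 -> s2 < y ->
  exists a b N, [/\ 0 < a, 0 < b &
    forall n, (N <= n)%N -> forall rho, s1 <= rho <= s2 -> a <= g n rho <= b].
Proof.
move=> xs s12 sy.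
have cH : {within `[s1, s2], continuous H}.
  apply: continuous_subspaceT; exact: (continuous_radial_norm HK pp kPQ Aer).
have [c + hc] := EVT_min s12 cH; have [d _ hd] := EVT_max s12 cH.
rewrite in_itv /= => /andP[c1 c2].
have Hc : 0 < H c by apply: radial_norm_gt0; apply/andP; split; lra.
have Hc2 : 0 < H c / 2 by lra.
have [N hN] := unif_radial_norm HK pp kPQ Aer Hc2.
exists (H c / 2), (H d + H c / 2), N; split=> //.
  have := hd c; rewrite in_itv /= c1 c2 => /(_ isT); lra.
move=> n hn rho hr; have := hN n hn rho; rewrite ler_norml => /andP[h1 h2].
have := hc rho; have := hd rho; rewrite in_itv /= hr => /(_ isT) h3 /(_ isT) h4.
apply/andP; split; lra.
Qed.

(** Every root gains a factor s1 / t1 > 1 in the log-convexity inequality, while the Gauss quotients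
    in it stay between positive bounds that do not depend on n. *)
Lemma nroots_bounded (s1 s2 : R) : x < s1 -> s1 <= s2 -> s2 < y ->
  exists N B, forall n, (N <= n)%N -> (nroots s1 s2 n <= B)%N.
Proof.
move=> xs s12 sy.
have s10 : 0 < s1 by exact: le_lt_trans xs.
have s20 : 0 < s2 by exact: lt_le_trans s12.
(* The first entry keeps [t1] above [x]; the second makes [t2] at most [(s2 + y) / 2], hence below
   [y]. *)
pose t1 := Num.max ((x + s1) / 2) (s1 * s2 / ((s2 + y) / 2)).
have y20 : 0 < (s2 + y) / 2 by lra.
have t1lt : t1 < s1.
  rewrite gt_max; apply/andP; split; first by lra.
  by rewrite ltr_pdivrMr // ltr_pM2l //; lra.
have t1x : x < t1 by rewrite lt_max; apply/orP; left; lra.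
have t10 : 0 < t1 by exact: le_lt_trans t1x.
pose t2 := s1 * s2 / t1.
have tE : t1 * t2 = s1 * s2 by rewrite mulrC divfK // gt_eqF.
have st2 : s2 <= t2 by rewrite ler_pdivlMr // mulrC ler_wpM2r // ltW.
have t2y : t2 < y.
  have : s1 * s2 / ((s2 + y) / 2) <= t1 by rewrite le_max lexx orbT.
  rewrite ler_pdivrMr // => h.
  rewrite ltr_pdivrMr //; apply: le_lt_trans h _.
  by rewrite mulrC ltr_pM2r //; lra.
have t12 : t1 <= t2 by lra.
have [a [b [N [a0 b0 hN]]]] := gauss_quot_bounds t1x t12 t2y.
pose th := t1 / s1.
have th0 : 0 < th by exact: divr_gt0.
have th1 : th < 1 by rewrite ltr_pdivrMr // mul1r.
have aabb : 0 < a * a / (b * b) by rewrite divr_gt0 // mulr_gt0.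
have [B hB] := expr_small (ltW th0) th1 aabb.
exists N, B => n hn; rewrite leqNgt; apply/negP => /ltnW /hB.
have hg rho : t1 <= rho <= t2 -> a <= g n rho <= b by exact: hN.
have := gauss_quot_logconvex n t1x (ltW t1lt) s12 st2 t2y tE.
have -> : s1 / t1 = th^-1 by rewrite /th invf_div.
set c := nroots _ _ _ => h1 h2.
have thc : 0 < th ^+ c by exact: exprn_gt0.
move: h1; rewrite exprVn mulrC ler_pdivrMr // => h1.
move: h2; rewrite ltr_pdivlMr ?mulr_gt0 // => h2.
have /andP[g1 _] : a <= g n s1 <= b by apply: hg; apply/andP; split; lra.
have /andP[g2 _] : a <= g n s2 <= b by apply: hg; apply/andP; split; lra.
have /andP[g3 g3'] : a <= g n t1 <= b by apply: hg; rewrite lexx.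
have /andP[g4 g4'] : a <= g n t2 <= b by apply: hg; rewrite lexx andbT.
have a1 : a * a <= g n s1 * g n s2 by rewrite ler_pM // ltW.
have a2 : g n t1 * g n t2 <= b * b by rewrite ler_pM //; lra.
have a3 : g n t1 * g n t2 * th ^+ c <= th ^+ c * (b * b).
  by rewrite mulrC ler_pM2l.
lra.
Qed.

(* Applied to a zero b of some k_m, this locates a zero of k_n within t of b. *)
Lemma numerator_root_near (s1 s2 t : R) : x < s1 -> s1 <= s2 -> s2 < y ->
  0 < t -> t <= s1 ->
  exists eta N, 0 < eta /\ forall n, (N <= n)%N ->
    forall b, s1 <= nrm (b - e) <= s2 -> nrm (q n b) < eta ->
    exists2 c, c \in poly_roots (P n) & nrm (c - b) < t.
Proof.
move=> xs s12 sy t0 ts.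
have [a [a' [N1 [a0 _ hN1]]]] := gauss_quot_bounds xs s12 sy.
have [N2 [B hB]] := nroots_bounded xs s12 sy.
have s20 : 0 < s2 by lra.
(* [a] bounds the Gauss quotients from below, and each of the at most [B] roots in the annulus costs
   a factor [t / s2]. *)
exists (a * (t / s2) ^+ B), (maxn N1 N2); split.
  by rewrite mulr_gt0 // exprn_gt0 // divr_gt0.
move=> n; rewrite geq_max => /andP[n1 n2] b hb hq.
apply: contrapT => hn.
have hc c : c \in poly_roots (P n) -> t <= nrm (c - b).
  by move=> hc; rewrite leNgt; apply/negP => h; apply: hn; exists c.
have bxy : x < nrm (b - e) < y.
  by case/andP: hb => b1 b2; apply/andP; split; lra.
have [br bS] := gap_radius bxy.
have ts2 : t <= s2 by lra.
have := nrm_horner_away_roots HK t0 ts2 hb hc.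
have D0 := gauss_den_gt0 HK kPQ Aer n (nrm (b - e)).
rewrite -(ler_pM2r (x := (gauss nrm (Q n) e (nrm (b - e)))^-1)) ?invr_gt0 //.
rewrite -mulrA -{2}(nrm_den HK kPQ Aer n br bS) -(nrm_div HK) => h.
have gE : g n (nrm (b - e)) =
    gauss nrm (P n) e (nrm (b - e)) / gauss nrm (Q n) e (nrm (b - e)).
  by rewrite /gauss_quot clamp_id // norm_ge0.
move: h; rewrite -gE => h.
have /andP[ag _] := hN1 n n1 _ hb.
have tB : (t / s2) ^+ B <= (t / s2) ^+ nroots s1 s2 n.
  apply: ler_wiXn2l (hB n n2); first by rewrite divr_ge0 // ltW.
  by rewrite ler_pdivrMr // mul1r.
have : a * (t / s2) ^+ B <= (t / s2) ^+ nroots s1 s2 n * g n (nrm (b - e)).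
  rewrite mulrC; apply: ler_pM => //; last exact: ltW.
  by rewrite exprn_ge0 // divr_ge0 // ltW.
lra.
Qed.

End Annulus.

(** * The monomial law on zero-free annuli *)

Lemma monomial_inj (R : realType) (C C' u v : R) (m m' : int) :
  0 < C -> 0 < C' -> 0 < u -> u < v ->
  C * u ^ m = C' * u ^ m' -> C * v ^ m = C' * v ^ m' -> C = C' /\ m = m'.
Proof.
move=> C0 C'0 u0 uv hu hv; have v0 := lt_trans u0 uv.
have em : m = m'.
  apply: (ieexprIz (x := v / u)); first exact: divr_gt0.
    by rewrite gt_eqF // ltr_pdivlMr // mul1r.
  rewrite !expfzMl !exprz_inv -!invr_expz.
  have um : u ^ m != 0 by rewrite expfz_neq0 // gt_eqF.
  have um' : u ^ m' != 0 by rewrite expfz_neq0 // gt_eqF.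
  apply/eqP; rewrite eqr_div //; apply/eqP.
  apply: (mulfI (x := C * C')); first by rewrite mulf_neq0 // gt_eqF.
  by rewrite mulrACA hv -hu; ring.
split=> //; apply: (mulIf (x := u ^ m)); first by rewrite expfz_neq0 // gt_eqF.
by rewrite hu em.
Qed.

Lemma horner_poly_root (K : closedFieldType) (P : {poly K}) c :
  c \in poly_roots P -> P.[c] = 0.
Proof.
have [->|P0] := eqVneq P 0; first by rewrite horner0.
by rewrite mem_poly_roots // => /rootP.
Qed.

Section AnnulusMonomial.
Variables (R : realType) (p : nat) (K : closedFieldType) (nrm : K -> R).
Hypothesis HK : is_Cp p nrm.
Hypothesis pp : prime p.
Variables (A : set K) (k : K -> K) (P Q : nat -> {poly K}).
Hypothesis kPQ : uniform_approx nrm A k P Q.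
Variables (e : K) (r : R) (S : seq R).
Hypothesis Aer : radial_domain nrm A e r S.
Variables (x y : R).
Hypotheses (x0 : 0 <= x) (yr : y <= r) (Sxy : gap S x y).
Hypothesis knz : forall z, x < nrm (z - e) < y -> k z != 0.

Local Notation g := (gauss_quot nrm P Q e r).
Local Notation H := (radial_norm nrm P Q e r).
Local Notation q n z := ((P n).[z] / (Q n).[z]).

Let Ae : A e. Proof. by case: Aer. Qed.
Let r0 : 0 < r. Proof. by case: Aer. Qed.
Let norm_ge0 := Cp_norm_ge0 HK.

(* Otherwise the zeros of the k_n in the annulus would accumulate at a zero
   of k. *)
Lemma numerator_root_free (s1 s2 : R) : x < s1 -> s1 <= s2 -> s2 < y ->
  exists N, forall n, (N <= n)%N -> forall c, c \in poly_roots (P n) ->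
    ~~ (s1 <= nrm (c - e) <= s2).
Proof.
move=> xs s12 sy; have s10 : 0 < s1 by exact: le_lt_trans xs.
(* Summable tolerances below [s1]: moving a point of the annulus by less than [th j] does not change
   its distance to [e], so the sequence built below never leaves its circle. *)
pose th j := s1 * (1 / 2) ^+ j.+1.
have th0 j : 0 < th j by rewrite mulr_gt0 // exprn_gt0 //; lra.
have thle i j : (i <= j)%N -> th j <= th i.
  by move=> ij; rewrite ler_pM2l //; apply: ler_wiXn2l => //; lra.
have ths j : th j < s1.
  apply: (@le_lt_trans _ _ (th 0%N)); first exact: thle.
  by rewrite /th expr1; lra.
have thlim eps : 0 < eps -> exists j, th j < eps.
  move=> e0; have [||J hJ] := @expr_small R (1 / 2) (eps / s1) _ _ (divr_gt0 e0 s10).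
  - lra.
  - lra.
  by exists J; rewrite /th mulrC -ltr_pdivlMr // hJ.
have [a [b [N0 [a0 b0 hN0]]]] := gauss_quot_bounds HK pp kPQ Aer x0 yr Sxy knz xs s12 sy.
have [eta heta] := choice (fun j => numerator_root_near HK pp kPQ Aer x0 yr Sxy knz
  xs s12 sy (th0 j) (ltW (ths j))).
have [N1 hN1] := choice heta.
(* [eta j] is what locates a root within [th j]; the bound by [th j] makes the approximation error
   tend to 0. *)
pose et j := Num.min (eta j) (th j).
have et0 j : 0 < et j by rewrite lt_min th0 andbT; case: (hN1 j).
have [N2 hN2] := choice (fun j => kPQ.2 _ (et0 j)).
pose N j := maxn (N1 j) (maxn (N2 j) N0).
(* Approximate zeros of [k] of order [j]: late approximants have a root near each of them, and roots
   of late approximants are such points. *)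
pose Z j z := s1 <= nrm (z - e) <= s2 /\ nrm (k z) < et j.
have annA z : s1 <= nrm (z - e) <= s2 -> x < nrm (z - e) < y.
  by move=> /andP[h1 h2]; rewrite (lt_le_trans xs h1) (le_lt_trans h2 sy).
have AA z : s1 <= nrm (z - e) <= s2 -> A z.
  by move=> /annA; exact: (annulus_domain Aer yr Sxy).
have near_root j z n : Z j z -> (N j <= n)%N ->
    exists2 c, c \in poly_roots (P n) & nrm (c - z) < th j.
  move=> [hz kz]; rewrite !geq_max => /and3P[n1 n2 n0].
  case: (hN1 j) => _ /(_ n n1 z hz); apply.
  have -> : q n z = k z - (k z - q n z) by ring.
  apply: lt_le_trans (_ : et j <= eta j); last by rewrite ge_min lexx.
  by apply: (nrmB_lt HK) => //; exact: hN2 (AA _ hz).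
have root_Z j c n : (N j <= n)%N -> c \in poly_roots (P n) ->
    s1 <= nrm (c - e) <= s2 -> Z j c.
  rewrite !geq_max => /and3P[n1 n2 n0] hc hce; split=> //.
  have := hN2 j n n2 c (AA _ hce).
  by rewrite (horner_poly_root hc) mul0r subr0.
have keep z c j : s1 <= nrm (z - e) <= s2 -> nrm (c - z) < th j ->
    nrm (c - e) = nrm (z - e).
  move=> /andP[h1 h2] h; apply: (nrm_dominant HK).
  have -> : c - e - (z - e) = c - z by ring.
  by apply: lt_trans h _; apply: lt_le_trans h1.
(* A root of an approximant late enough for both orders [j] and [j.+1] is near [z] and is an
   approximate zero of the next order. *)
have step j z : exists c, Z j z -> Z j.+1 c /\ nrm (c - z) < th j.
  have [hz|hz] := pselect (Z j z); last by exists z.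
  have [c c1 c2] := near_root j z (maxn (N j) (N j.+1)) hz (leq_maxl _ _).
  exists c => _; split=> //; apply: root_Z (leq_maxr (N j) _) c1 _.
  by rewrite (keep z c j) //; case: hz.
pose G j := projT1 (choice (step j)).
have hG j : forall z, Z j z -> Z j.+1 (G j z) /\ nrm (G j z - z) < th j.
  exact: projT2 (choice (step j)).
apply: contrapT => hno.
have hroot n : exists m c, [/\ (n <= m)%N, c \in poly_roots (P m) &
    s1 <= nrm (c - e) <= s2].
  apply: contrapT => h; apply: hno; exists n => m nm c hc; apply/negP => hce.
  by apply: h; exists m, c.
have [m0 [c0 [hm0 hc0 hce0]]] := hroot (N 0%N).
pose u := fix u j := if j is i.+1 then G i (u i) else c0.
have hu j : Z j (u j).
  elim: j => [|j IH] /=; first exact: (root_Z _ _ _ hm0 hc0 hce0).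
  by case: (hG j (u j) IH).
have hd j : nrm (u j.+1 - u j) < th j by case: (hG j (u j) (hu j)).
have hd2 j i : nrm (u (j + i)%N - u j) < th j.
  elim: i => [|i IH]; first by rewrite addn0 subrr (nrm0 HK).
  rewrite addnS; apply: (nrm_dist_lt_trans HK) IH.
  by apply: lt_le_trans (hd _) _; apply: thle; exact: leq_addr.
have hd3 j i : (j <= i)%N -> nrm (u i - u j) < th j.
  by move=> /subnKC <-.
have cu : cauchy_seq nrm u.
  move=> eps /thlim[J hJ]; exists J => m n Jm Jn; apply: lt_trans hJ.
  by apply: (nrm_dist_lt_trans HK (y := u J)); [|rewrite (nrm_distC HK)]; exact: hd3.
have [l _ hl] := Cp_complete HK (fun n => isT) cu.
have lu j : nrm (l - u j) < th j.
  have [n hn] := hl _ (th0 j).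
  apply: (nrm_dist_lt_trans HK (y := u (maxn n j))).
    by rewrite (nrm_distC HK); apply: hn; exact: leq_maxl.
  by apply: hd3; exact: leq_maxr.
have hle : s1 <= nrm (l - e) <= s2.
  by rewrite (keep (u 0%N) l 0%N) //; case: (hu 0%N).
have kl : 0 < nrm (k l) by rewrite (nrm_gt0 HK) knz // annA.
have [lr lS] := gap_radius yr Sxy (annA _ hle).
(* The approximant of index [N j] has a root within [th j] of [l], so its value at [l] is at most
   [b / s1 * th j], and its distance to [k l] is at most [th j]. For large [j] both fall below
   [nrm (k l)]. *)
have bs0 : 0 < 1 + b / s1 by have := divr_gt0 b0 s10; lra.
have [j hj] := thlim _ (divr_gt0 kl bs0).
have [c hc hcu] := near_root j (u j) (N j) (hu j) (leqnn _).
have hcl : nrm (c - l) < th j.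
  by apply: (nrm_dist_lt_trans HK hcu); rewrite (nrm_distC HK).
have D0 := gauss_den_gt0 HK kPQ Aer (N j) (nrm (l - e)).
have := nrm_horner_near_root HK e l hc.
rewrite -(ler_pM2r (x := (gauss nrm (Q (N j)) e (nrm (l - e)))^-1)) ?invr_gt0 //.
rewrite [leLHS]mulrAC [leRHS]mulrAC -{1}(nrm_den HK kPQ Aer (N j) lr lS).
rewrite -(nrm_div HK).
have -> : gauss nrm (P (N j)) e (nrm (l - e)) /
    gauss nrm (Q (N j)) e (nrm (l - e)) = g (N j) (nrm (l - e)).
  by rewrite /gauss_quot clamp_id // norm_ge0.
have Nj0 : (N0 <= N j)%N by rewrite !leq_max leqnn !orbT.
have /andP[_ gb] := hN0 _ Nj0 _ hle.
move=> hq.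
have hq2 : nrm (q (N j) l) * s1 <= b * th j.
  apply: (@le_trans _ _ (nrm (q (N j) l) * nrm (l - e))).
    by rewrite ler_wpM2l //; case/andP: hle.
  apply: le_trans hq _; apply: ler_pM => //; last exact: ltW.
  exact: (gauss_quot_ge0 HK).
have Nj2 : (N2 j <= N j)%N by rewrite !leq_max leqnn !orbT.
have hkq : nrm (k l - q (N j) l) <= (1 + b / s1) * th j.
  apply: (@le_trans _ _ (th j)).
    apply: ltW; apply: lt_le_trans (hN2 j _ Nj2 l (AA _ hle)) _.
    by rewrite ge_min lexx orbT.
  by rewrite ler_peMl ?ltW //; have := divr_gt0 b0 s10; lra.
have hq3 : nrm (q (N j) l) <= (1 + b / s1) * th j.
  apply: (@le_trans _ _ (b / s1 * th j)).
    by rewrite mulrAC ler_pdivlMr.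
  by rewrite ler_pM2r //; lra.
have : nrm (k l) <= (1 + b / s1) * th j.
  by rewrite -(subrK (q (N j) l) (k l)); exact: (nrmD_le HK).
by rewrite leNgt mulrC -ltr_pdivlMr // hj.
Qed.

(** Late approximants have no zero in the closed annulus and absolute value at least a there, more
    than their distance to k. Hence |k| equals their Gauss quotient exactly, not only in the limit,
    and one index N suffices. *)
Lemma annulus_monomial_closed (s1 s2 : R) : x < s1 -> s1 < s2 -> s2 < y ->
  exists (C : R) (m : int), [/\ 0 < C,
    forall rho, s1 <= rho <= s2 -> H rho = C * rho ^ m &
    forall z, s1 <= nrm (z - e) <= s2 -> nrm (k z) = H (nrm (z - e))].
Proof.
move=> xs s12 sy; have s10 : 0 < s1 by exact: le_lt_trans xs.
have yr' := yr.
have [a [b [N0 [a0 b0 hN0]]]] :=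
  gauss_quot_bounds HK pp kPQ Aer x0 yr Sxy knz xs (ltW s12) sy.
have [N1 hN1] := numerator_root_free xs (ltW s12) sy.
have [N2 hN2] := kPQ.2 _ a0.
pose N := maxn N0 (maxn N1 N2).
have annA z : s1 <= nrm (z - e) <= s2 -> x < nrm (z - e) < y.
  by move=> /andP[h1 h2]; rewrite (lt_le_trans xs h1) (le_lt_trans h2 sy).
have knE z n : s1 <= nrm (z - e) <= s2 -> (N <= n)%N ->
    nrm (k z) = g n (nrm (z - e)).
  move=> hz; rewrite !geq_max => /and3P[n0 n1 n2].
  have [zr zS] := gap_radius yr Sxy (annA _ hz).
  have qE : nrm (q n z) = g n (nrm (z - e)).
    apply: (nrm_quot HK kPQ Aer) => // c hc.
    by apply: contraNneq (hN1 n n1 c hc) => ->.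
  rewrite -qE; apply: (nrm_dominant HK).
  apply: lt_le_trans (hN2 n n2 z (annulus_domain Aer yr Sxy (annA _ hz))) _.
  by rewrite qE; case/andP: (hN0 n n0 _ hz).
have kH z : s1 <= nrm (z - e) <= s2 -> nrm (k z) = H (nrm (z - e)).
  move=> hz; have h : (g ^~ (nrm (z - e))) @ \oo --> nrm (k z).
    by apply: cvg_near_cst; exists N => // n /= Nn; rewrite -knE.
  by rewrite /radial_norm (cvg_lim _ h).
have HgN rho : s1 <= rho <= s2 -> H rho = g N rho.
  move=> hrho.
  have eqv z : s1 < nrm z < s2 -> nrm z \notin [::] -> H (nrm z) = g N (nrm z).
    move=> /andP[h1 h2] _; have ez : nrm (z + e - e) = nrm z by rewrite addrK.
    by rewrite -ez -kH ?ez ?(ltW h1) ?(ltW h2) // (knE _ N) // ez ?(ltW h1) ?(ltW h2).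
  have cH := continuous_radial_norm HK pp kPQ Aer.
  have cg := @continuous_gauss_quot _ _ _ _ HK _ _ _ _ kPQ _ _ _ Aer N.
  apply/le_anti/andP; split; rewrite -subr_ge0.
    apply: (ge0_dense_radii (s := [::]) (G := fun t => g N t - H t)
      HK pp (ltW s10) s12) => //.
      by move=> t; apply: cvgB; [exact: cg|exact: cH].
    by move=> z h1 h2; rewrite eqv // subrr.
  apply: (ge0_dense_radii (s := [::]) (G := fun t => H t - g N t)
    HK pp (ltW s10) s12) => //.
    by move=> t; apply: cvgB; [exact: cH|exact: cg].
  by move=> z h1 h2; rewrite eqv // subrr.
have P0 : P N != 0.
  apply: contraTneq a0 => P0; rewrite -leNgt.
  have /andP[+ _] := hN0 N (leq_maxl _ _) s1 (introT andP (conj (lexx _) (ltW s12))).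
  by rewrite /gauss_quot P0 /gauss lead_coef0 (nrm0 HK) !mul0r.
have Q0 : Q N != 0.
  by apply: contraTneq (kPQ.1 N e Ae) => ->; rewrite horner0 eqxx.
have PN : forall c, c \in poly_roots (P N) -> ~~ (s1 <= nrm (c - e) <= s2).
  by apply: hN1; rewrite !leq_max leqnn !orbT.
have QN : forall c, c \in poly_roots (Q N) -> ~~ (s1 <= nrm (c - e) <= s2).
  by move=> c hc; apply: contra (den_root_annulus kPQ Aer yr Sxy hc) => /annA.
have [C1 [n1 [C10 h1]]] := gauss_monomial HK P0 s10 (ltW s12) PN.
have [C2 [n2 [C20 h2]]] := gauss_monomial HK Q0 s10 (ltW s12) QN.
exists (C1 / C2), (n1%:Z - n2%:Z); split=> [|rho hrho|//]; first exact: divr_gt0.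
have rho0 : 0 < rho by case/andP: hrho => h _; exact: lt_le_trans h.
rewrite HgN // /gauss_quot clamp_id; last first.
  by case/andP: hrho => h h'; apply/andP; split; lra.
rewrite h1 // h2 // expfzDr ?gt_eqF // -invr_expz -!exprnP.
by rewrite mulf_div.
Qed.

(** Each radius lies in a closed subannulus that also contains u and v; the monomials found there
    agree at two points, so they are all the same. *)
Lemma annulus_monomial : x < y -> exists (C : R) (m : int), [/\ 0 < C,
    forall rho, x < rho < y -> H rho = C * rho ^ m &
    forall z, x < nrm (z - e) < y -> nrm (k z) = H (nrm (z - e))].
Proof.
move=> xy; pose u := (2 * x + y) / 3; pose v := (x + 2 * y) / 3.
have xu : x < u by rewrite /u; lra.
have uv : u < v by rewrite /u /v; lra.
have vy : v < y by rewrite /v; lra.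
have u0 : 0 < u by exact: le_lt_trans xu.
have [C [m [C0 hC hk]]] := annulus_monomial_closed xu uv vy.
have glue rho : x < rho < y -> H rho = C * rho ^ m /\
    (forall z, nrm (z - e) = rho -> nrm (k z) = H rho).
  move=> /andP[xrho rhoy]; pose u' := Num.min u rho; pose v' := Num.max v rho.
  have u'u : u' <= u by rewrite ge_min lexx.
  have vv' : v <= v' by rewrite le_max lexx.
  have hrho : u' <= rho <= v' by rewrite ge_min le_max lexx !orbT.
  have [|||C' [m' [C'0 hC' hk']]] := @annulus_monomial_closed u' v'.
  - by rewrite lt_min xu.
  - by apply: le_lt_trans u'u _; apply: lt_le_trans vv'.
  - by rewrite gt_max vy.
  have [||eC em] := @monomial_inj _ C C' u v m m' C0 C'0 u0 uv.
  - by rewrite -hC ?hC' ?u'u ?lexx //= ?(ltW uv) // (le_trans (ltW uv)).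
  - by rewrite -hC ?hC' ?vv' ?lexx //= ?(ltW uv) // andbT (le_trans u'u) // ltW.
  split=> [|z hz]; first by rewrite eC em; exact: hC'.
  by rewrite -hz hk' // hz.
exists C, m; split=> // [rho /glue[]//|z hz].
by case: (glue _ hz) => _; apply.
Qed.

End AnnulusMonomial.

(** * Crossing the exceptional radii *)

Section GapArguments.
Variables (R : realType) (p : nat) (K : closedFieldType) (nrm : K -> R).
Hypothesis HK : is_Cp p nrm.
Hypothesis pp : prime p.

Lemma constant_closure (G : R -> R) (x y c : R) : 0 <= x -> x < y ->
  continuous G -> (forall t, x < t < y -> G t = c) -> G x = c /\ G y = c.
Proof.
move=> x0 xy cG hG.
have aux t : x <= t <= y -> G t = c.
  move=> ht; apply/le_anti/andP; split; rewrite -subr_ge0.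
    apply: (ge0_dense_radii (s := [::]) (G := fun t => c - G t) HK pp x0 xy) => //.
      by move=> u; apply: cvgB; [exact: cvg_cst|exact: cG].
    by move=> z hz _; rewrite hG ?subrr.
  apply: (ge0_dense_radii (s := [::]) (G := fun t => G t - c) HK pp x0 xy) => //.
    by move=> u; apply: cvgB; [exact: cG|exact: cvg_cst].
  by move=> z hz _; rewrite hG ?subrr.
by split; apply: aux; rewrite lexx ltW.
Qed.

(** Induction on S, cutting the interval at each exceptional radius; continuity joins the two
    pieces. *)
Lemma constant_across_gaps (S : seq R) (G : R -> R) (x y : R) :
  0 <= x -> x < y -> continuous G ->
  (forall u v, x <= u -> u < v -> v <= y -> gap S u v ->
    forall s t, u < s < v -> u < t < v -> G s = G t) ->
  G x = G y.
Proof.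
move=> x0 xy cG; elim: S x y x0 xy => [|t S IH] x y x0 xy hG.
  have hm : x < (x + y) / 2 < y by apply/andP; split; lra.
  have [|-> ->//] := @constant_closure G x y (G ((x + y) / 2)) x0 xy cG.
  by move=> s hs; exact: (hG x y).
have gapS u v : gap S u v -> ~~ (u < t < v) -> gap (t :: S) u v.
  by move=> h1 h2 s; rewrite in_cons => /orP[/eqP->//|]; exact: h1.
have [/andP[xt ty]|hn] := boolP (x < t < y).
  have t0 : 0 <= t by lra.
  rewrite (IH x t x0 xt) ?(IH t y t0 ty) // => u v xu uv vy hg; apply: (hG u v) => //.
  - lra.
  - by apply: gapS => //; apply/negP => /andP[]; lra.
  - lra.
  - by apply: gapS => //; apply/negP => /andP[]; lra.
apply: IH => // u v xu uv vy hg; apply: (hG u v) => //.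
apply: gapS => //; apply: contra hn => /andP[h1 h2]; apply/andP; split; lra.
Qed.

Lemma gap_left (S : seq R) (y : R) : 0 < y ->
  exists x, [/\ 0 <= x, x < y & gap S x y].
Proof.
move=> y0; elim: S => [|t S [x [x0 xy hg]]]; first by exists 0.
have [/andP[xt ty]|hn] := boolP (x < t < y).
  exists t; split=> //; first by lra.
  move=> s; rewrite in_cons => /orP[/eqP->|/hg]; first by rewrite ltxx.
  by apply: contra => /andP[h1 h2]; apply/andP; split; lra.
exists x; split=> // s; rewrite in_cons => /orP[/eqP->//|]; exact: hg.
Qed.

Lemma exprz_ge_min (u v t : R) (m : int) :
  0 < u -> u <= t -> t <= v -> Num.min (u ^ m) (v ^ m) <= t ^ m.
Proof.
move=> u0 ut tv; have t0 : 0 < t by lra.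
rewrite ge_min; case: m => n.
  by rewrite -!exprnP lerXn2r // nnegrE ltW.
rewrite NegzE -!invr_expz -!exprnP; apply/orP; right.
have v0 : 0 < v by lra.
by rewrite lef_pV2 ?posrE ?exprn_gt0 // lerXn2r // nnegrE ltW.
Qed.

(** A positive radius, even an exceptional one, is the right end of a gap, and the monomial on that
    gap stays away from 0 as the radius increases to this end. At radius 0 the value is |k e|. *)
Lemma radial_norm_pos (A : set K) (k : K -> K) P Q e r (S : seq R) :
  uniform_approx nrm A k P Q -> radial_domain nrm A e r S ->
  (forall z, A z -> k z != 0) ->
  forall rho, 0 < radial_norm nrm P Q e r rho.
Proof.
move=> kPQ Aer knz rho; have [Ae r0 Ar] := Aer.
rewrite -(radial_norm_clamp P Q Aer).
have /andP[] := clamp_itv rho r0; set t := clamp r rho.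
rewrite le_eqVlt => /orP[/eqP <- _|t0 tr].
  by rewrite (radial_norm_center HK kPQ Aer) (nrm_gt0 HK) knz.
have [x [x0 xt hg]] := gap_left S t0.
have kn z : x < nrm (z - e) < t -> k z != 0.
  by move=> /(annulus_domain Aer tr hg); exact: knz.
have [C [m [C0 hC _]]] := annulus_monomial HK pp kPQ Aer x0 tr hg kn xt.
pose u := (x + t) / 2.
have u0 : 0 < u by rewrite /u; lra.
have ut : u < t by rewrite /u; lra.
have xu : x < u by rewrite /u; lra.
pose c := C * Num.min (u ^ m) (t ^ m).
have c0 : 0 < c by rewrite mulr_gt0 // lt_min !exprz_gt0.
apply: lt_le_trans c0 _; rewrite -subr_ge0.
apply: (ge0_dense_radii (s := [::])
  (G := fun s => radial_norm nrm P Q e r s - c) HK pp (ltW u0) ut).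
- move=> s; apply: cvgB; last exact: cvg_cst.
  exact: (continuous_radial_norm HK pp kPQ Aer).
- move=> z /andP[h1 h2] _; rewrite subr_ge0 hC; last by rewrite h2 (lt_trans xu).
  by rewrite ler_pM2l // exprz_ge_min // ltW.
- by rewrite lexx ltW.
Qed.

(** If the two exponents agreed on every gap, the quotient would be constant on each gap, hence on
    the whole interval from 0 to r. *)
Lemma nonconstant_annulus (A : set K) (k1 k2 : K -> K) P1 Q1 P2 Q2 e r S :
  uniform_approx nrm A k1 P1 Q1 -> uniform_approx nrm A k2 P2 Q2 ->
  (forall z, A z -> k1 z != 0) -> (forall z, A z -> k2 z != 0) ->
  radial_domain nrm A e r S ->
  radial_norm nrm P1 Q1 e r 0 / radial_norm nrm P2 Q2 e r 0 !=
  radial_norm nrm P1 Q1 e r r / radial_norm nrm P2 Q2 e r r ->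
  exists (x y C : R) (m : int), [/\ 0 <= x, x < y, y <= r & gap S x y] /\
    [/\ 0 < C, m != 0 & forall z, x < nrm (z - e) < y ->
        nrm (k1 z) / nrm (k2 z) = C * nrm (z - e) ^ m].
Proof.
move=> h1 h2 n1 n2 Aer; have [Ae r0 Ar] := Aer.
set H1 := radial_norm nrm P1 Q1 e r; set H2 := radial_norm nrm P2 Q2 e r.
move=> hne; apply: contrapT => hno; move/eqP: hne; apply.
pose G t := H1 t / H2 t.
have H2pos t : 0 < H2 t by exact: radial_norm_pos h2 Aer n2 t.
have cG : continuous G.
  move=> t; suff : (fun t => H1 t * (H2 t)^-1) @ t --> H1 t * (H2 t)^-1 by [].
  apply: cvgM; first exact: (continuous_radial_norm HK pp h1 Aer).
  apply: cvgV; first by rewrite gt_eqF.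
  exact: (continuous_radial_norm HK pp h2 Aer).
apply: (constant_across_gaps (S := S) (G := G)) => // u v u0 uv vr hg s t hs ht.
have kn1 z : u < nrm (z - e) < v -> k1 z != 0.
  by move=> /(annulus_domain Aer vr hg); exact: n1.
have kn2 z : u < nrm (z - e) < v -> k2 z != 0.
  by move=> /(annulus_domain Aer vr hg); exact: n2.
have [C1 [m1 [C10 hC1 hk1]]] := annulus_monomial HK pp h1 Aer u0 vr hg kn1 uv.
have [C2 [m2 [C20 hC2 hk2]]] := annulus_monomial HK pp h2 Aer u0 vr hg kn2 uv.
have GE w : u < w < v -> H1 w / H2 w = C1 / C2 * w ^ (m1 - m2).
  move=> /[dup] hw /andP[uw _]; rewrite /H1 hC1 // /H2 hC2 //.
  have w0 : w != 0 by rewrite gt_eqF // (le_lt_trans u0).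
  by rewrite expfzDr // -invr_expz mulf_div.
rewrite /G !GE //; have [m0|m0] := eqVneq (m1 - m2) 0; first by rewrite m0 !expr0z.
case: hno; exists u, v, (C1 / C2), (m1 - m2); split=> //; split=> //.
  exact: divr_gt0.
by move=> z hz; rewrite hk1 // hk2 // GE.
Qed.

(** Follow the quotient from a up to radius |a - b|, where a and b are interchangeable as centres,
    then down to b: it must change on one of the two halves. *)
Lemma quotient_nonconstant (A : set K) (k1 k2 : K -> K) P1 Q1 P2 Q2 a b :
  uniform_approx nrm A k1 P1 Q1 -> uniform_approx nrm A k2 P2 Q2 ->
  (forall z, A z -> k1 z != 0) -> (forall z, A z -> k2 z != 0) ->
  (forall e, A e -> exists S, radial_domain nrm A e (nrm (a - b)) S) ->
  A a -> A b ->
  nrm (k1 a) / nrm (k2 a) != nrm (k1 b) / nrm (k2 b) ->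
  exists (e : K) (S : seq R) (x y C : R) (m : int),
    [/\ radial_domain nrm A e (nrm (a - b)) S,
        [/\ 0 <= x, x < y, y <= nrm (a - b) & gap S x y] &
    [/\ 0 < C, m != 0 & forall z, x < nrm (z - e) < y ->
        nrm (k1 z) / nrm (k2 z) = C * nrm (z - e) ^ m]].
Proof.
move=> h1 h2 n1 n2 dom Aa Ab hne.
have [Sa da] := dom a Aa; have [Sb db] := dom b Ab.
set r := nrm (a - b) in dom da db *.
have r0 : 0 < r by case: da.
pose G e t := radial_norm nrm P1 Q1 e r t / radial_norm nrm P2 Q2 e r t.
have Ga : G a 0 = nrm (k1 a) / nrm (k2 a).
  by rewrite /G (radial_norm_center HK h1 da) (radial_norm_center HK h2 da).
have Gb : G b 0 = nrm (k1 b) / nrm (k2 b).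
  by rewrite /G (radial_norm_center HK h1 db) (radial_norm_center HK h2 db).
have Gr : G a r = G b r.
  by rewrite /G !(radial_norm_recenter _ _ HK r0 (lexx r)).
have [ea|ea] := eqVneq (G a 0) (G a r).
  have eb : G b 0 != G b r by rewrite -Gr -ea Ga Gb eq_sym.
  have [x [y [C [m [H1 H2]]]]] := nonconstant_annulus h1 h2 n1 n2 db eb.
  by exists b, Sb, x, y, C, m.
have [x [y [C [m [H1 H2]]]]] := nonconstant_annulus h1 h2 n1 n2 da ea.
by exists a, Sa, x, y, C, m.
Qed.

End GapArguments.

(** * Rigidity of symmetric kernels *)

(** Bernoulli's inequality for 1 - d; dividing by M + 1 makes the final inequality strict and covers
    M = 0. *)
Lemma expr_near_one (R : realType) (l : R) (M : nat) : 0 < l -> l < 1 ->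
  exists2 h, 0 < h < 1 & forall t, h < t -> t < 1 -> l < t ^+ M.
Proof.
move=> l0 l1; pose d := (1 - l) / M.+1%:R.
have M0 : 0 < M.+1%:R :> R by rewrite ltr0n.
have d0 : 0 < d by rewrite divr_gt0 //; lra.
have dM : d * M.+1%:R = 1 - l by rewrite divfK // gt_eqF.
have d1 : d < 1.
  by rewrite ltr_pdivrMr // mul1r; apply: (@lt_le_trans _ _ 1); [lra|rewrite ler1n].
have bern n : 1 - n%:R * d <= (1 - d) ^+ n.
  elim: n => [|n IH]; first by rewrite expr0 mul0r subr0.
  rewrite exprS; apply: (@le_trans _ _ ((1 - d) * (1 - n%:R * d))).
    have : 0 <= n%:R * d * d.
      by apply: mulr_ge0; [apply: mulr_ge0 => //; exact: ltW|exact: ltW].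
    rewrite -natr1; lra.
  by rewrite ler_wpM2l //; lra.
exists (1 - d); first by apply/andP; split; lra.
move=> t ht t1; apply: (@lt_le_trans _ _ ((1 - d) ^+ M)); last first.
  by apply: lerXn2r; rewrite ?nnegrE; lra.
apply: lt_le_trans (bern M); move: dM; rewrite -natr1; lra.
Qed.

Lemma exprz_not_between (R : realType) (l : R) (j : int) :
  0 < l -> l < 1 -> ~~ (l < l ^ j < 1).
Proof.
move=> l0 l1; apply/negP => /andP[].
case: j => [[|n]|n].
- by rewrite expr0z ltxx.
- rewrite -exprnP exprS => h _.
  have : l * l ^+ n <= l by apply: ler_piMr; [exact: ltW|apply: exprn_ile1; exact: ltW].
  lra.
- rewrite NegzE -invr_expz -exprnP => _; rewrite invf_lt1 ?exprn_gt0 // => h.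
  have : l ^+ n.+1 <= 1 by apply: exprn_ile1; exact: ltW.
  lra.
Qed.

Section SymmetricKernel.
Variables (R : realType) (p : nat) (K : closedFieldType) (nrm : K -> R).
Hypothesis HK : is_Cp p nrm.
Hypothesis pp : prime p.
Variables (A : set K) (kk : K -> K -> K) (P Q : K -> nat -> {poly K}).
Hypothesis kkPQ : forall y, A y -> uniform_approx nrm A (kk y) (P y) (Q y).
Hypothesis kk_neq0 : forall y z, A y -> A z -> kk y z != 0.
Hypothesis kkC : forall y z, A y -> A z -> kk y z = kk z y.
Hypothesis dom : forall a b e, A a -> A b -> A e -> a != b ->
  exists S, radial_domain nrm A e (nrm (a - b)) S.

(* As a function of y, |kk y z / kk y z'| takes its values in a discrete group
   when z and z' lie in the same annulus, so it cannot vary with y. *)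
Lemma symmetric_kernel_quotient a b c d : A a -> A b -> A c -> A d ->
  nrm (kk c a) / nrm (kk d a) = nrm (kk c b) / nrm (kk d b).
Proof.
move=> Aa Ab Ac Ad; have norm_ge0 := Cp_norm_ge0 HK.
have [<-//|ab] := eqVneq a b.
have [<-|cd] := eqVneq c d.
  by rewrite !divff // (nrm_eq0 HK) kk_neq0.
apply/eqP; apply: contraT => hne.
have [e [S [x [y [C [m [Aer [x0 xy yr hg] [C0 m0 hq]]]]]]]] :=
  quotient_nonconstant HK pp (kkPQ Ac) (kkPQ Ad)
    (fun u => @kk_neq0 c u Ac) (fun u => @kk_neq0 d u Ad)
    (fun e Ae => dom Aa Ab Ae ab) Aa Ab hne.
have [z0 /andP[xz zy]] := value_dense HK pp x0 xy.
have [z1 /andP[zz zy']] := value_dense HK pp (norm_ge0 z0) zy.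
pose z := z0 + e; pose z' := z1 + e.
have ez : nrm (z - e) = nrm z0 by rewrite addrK.
have ez' : nrm (z' - e) = nrm z1 by rewrite addrK.
have hz : x < nrm (z - e) < y by rewrite ez xz.
have hz' : x < nrm (z' - e) < y by rewrite ez' zy' (lt_trans xz).
have Az := annulus_domain Aer yr hg hz; have Az' := annulus_domain Aer yr hg hz'.
have zp : 0 < nrm z0 by exact: le_lt_trans xz.
have zp' : 0 < nrm z1 by exact: lt_trans zz.
pose l := nrm z0 / nrm z1.
have l0 : 0 < l by exact: divr_gt0.
have l1 : l < 1 by rewrite ltr_pdivrMr // mul1r.
(* The constant [D] cancels in the quotient: only the exponent [j] depends on [w]. *)
have hv w : A w -> exists j, nrm (kk z w) / nrm (kk z' w) = l ^ j.
  move=> Aw; have kw0 u : x < nrm (u - e) < y -> kk w u != 0.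
    by move=> /(annulus_domain Aer yr hg); exact: kk_neq0.
  have [D [j [D0 hD hk]]] := annulus_monomial HK pp (kkPQ Aw) Aer x0 yr hg kw0 xy.
  exists j; rewrite (kkC Az Aw) (kkC Az' Aw) !hk // !hD // ez ez'.
  rewrite /l expfzMl exprz_inv -invr_expz -mulf_div.
  by rewrite divff ?mul1r // gt_eqF.
(* By symmetry, equality would say that the monomial of exponent [m] takes the same value at [z] and
   [z'], that is [l ^ m = 1], although [m != 0] and [l < 1]. *)
have hne2 : nrm (kk z c) / nrm (kk z' c) != nrm (kk z d) / nrm (kk z' d).
  have := hq z hz; have := hq z' hz'.
  rewrite (kkC Ac Az) (kkC Ad Az) (kkC Ac Az') (kkC Ad Az') ez ez' => h' h.
  have nz u v : A u -> A v -> nrm (kk u v) != 0.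
    by move=> Au Av; rewrite (nrm_eq0 HK) kk_neq0.
  rewrite eqr_div ?nz //; apply/eqP => hE.
  have : nrm (kk z c) / nrm (kk z d) = nrm (kk z' c) / nrm (kk z' d).
    by apply/eqP; rewrite eqr_div ?nz // hE mulrC.
  rewrite h h' => /(mulfI (negbT (gt_eqF C0))) zm.
  have : l ^ m == 1.
    by rewrite /l expfzMl exprz_inv -invr_expz zm divff // expfz_neq0 // gt_eqF.
  by rewrite pexprz_eq1 ?(ltW l0) // (negbTE m0) (lt_eqF l1).
have [e' [S' [x' [y' [C' [m' [Aer' [x0' xy' yr' hg'] [C0' m0' hq']]]]]]]] :=
  quotient_nonconstant HK pp (kkPQ Az) (kkPQ Az')
    (fun u => @kk_neq0 z u Az) (fun u => @kk_neq0 z' u Az')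
    (fun e Ae => dom Ac Ad Ae cd) Ac Ad hne2.
(* Two radii with ratio [s] between [t] and 1 give [s ^+ |m'|] strictly between [l] and 1, where
   there is no integral power of [l]. *)
have [t /andP[t0 t1] ht] := expr_near_one `|m'|%N l0 l1.
have [w2 /andP[xw2 wy2]] := value_dense HK pp x0' xy'.
have w2p : 0 < nrm w2 by exact: le_lt_trans xw2.
have [w1 /andP[]] : exists w1 : K, Num.max x' (t * nrm w2) < nrm w1 < nrm w2.
  apply: (value_dense HK pp); first by rewrite le_max x0'.
  by rewrite gt_max xw2 /= -[ltRHS]mul1r ltr_pM2r.
rewrite gt_max => /andP[xw1 tw1] w12.
have w1p : 0 < nrm w1 by exact: le_lt_trans xw1.
have ew w : nrm (w + e' - e') = nrm w by rewrite addrK.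
have hw1 : x' < nrm (w1 + e' - e') < y' by rewrite ew xw1 (lt_trans w12).
have hw2 : x' < nrm (w2 + e' - e') < y' by rewrite ew xw2.
have [j1 hj1] := hv _ (annulus_domain Aer' yr' hg' hw1).
have [j2 hj2] := hv _ (annulus_domain Aer' yr' hg' hw2).
pose s := nrm w1 / nrm w2.
have s0 : 0 < s by exact: divr_gt0.
have s1 : s < 1 by rewrite ltr_pdivrMr // mul1r.
have ts : t < s by rewrite ltr_pdivlMr.
have sm : s ^ m' = l ^ (j1 - j2).
  rewrite expfzDr ?gt_eqF // -invr_expz -hj1 -hj2 !hq' // !ew.
  rewrite /s expfzMl exprz_inv -invr_expz -mulf_div.
  by rewrite divff ?mul1r // gt_eqF.
have lsM := ht s ts s1.
have sM1 : s ^+ `|m'|%N < 1 by rewrite expr_lt1 ?(ltW s0) // absz_gt0.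
have [j hj] : exists j, s ^+ `|m'|%N = l ^ j.
  case: (m') sm {lsM sM1} => n; first by exists (j1 - j2).
  rewrite NegzE -invr_expz -exprnP => h; exists (- (j1 - j2)).
  by rewrite -invr_expz -h invrK.
by have := exprz_not_between j l0 l1; rewrite -hj lsM sM1.
Qed.

End SymmetricKernel.

(** * Difference quotients and their uniform limits *)

(* The numerator of the difference quotient of P / Q between y and X, whose
   denominator is Q(y) Q. *)
Definition dq_num (K : fieldType) (P Q : {poly K}) (y : K) : {poly K} :=
  (Q.[y] *: P - P.[y] *: Q) %/ ('X - y%:P).

Definition dq (K : fieldType) (P Q : {poly K}) (y z : K) : K :=
  (dq_num P Q y).[z] / (Q.[y] *: Q).[z].

Lemma dq_numE (K : fieldType) (P Q : {poly K}) y :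
  dq_num P Q y * ('X - y%:P) = Q.[y] *: P - P.[y] *: Q.
Proof.
by apply: divpK; rewrite dvdp_XsubCl rootE !hornerE mulrC subrr.
Qed.

Lemma dqE (K : fieldType) (P Q : {poly K}) y z : Q.[y] != 0 -> Q.[z] != 0 ->
  dq P Q y z * (z - y) = P.[z] / Q.[z] - P.[y] / Q.[y].
Proof.
move=> Qy Qz; have := congr1 (fun U => U.[z]) (dq_numE P Q y).
rewrite hornerM !hornerE /dq !hornerE => hE.
by rewrite mulrAC hE; field; rewrite Qy Qz.
Qed.

Lemma dq_diag (K : fieldType) (P : {poly K}) y : dq P 1 y y = P^`().[y].
Proof.
have := congr1 (fun U => U^`().[y]) (dq_numE P 1 y).
rewrite derivM derivXsubC derivB !derivZ (derivC 1) !hornerE subrr mulr0 add0r.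
by rewrite /dq !hornerE divr1 => ->; rewrite subr0.
Qed.

Section DifferenceQuotient.
Variables (R : realType) (p : nat) (K : closedFieldType) (nrm : K -> R).
Hypothesis HK : is_Cp p nrm.
Hypothesis pp : prime p.
Let norm_ge0 := Cp_norm_ge0 HK.

(** |V| is constant on the disc, having no root there, and |U| on a smaller disc is at most its
    Gauss norm, which is attained at a point of the outer annulus whose distance to y differs from
    that of every root. *)
Lemma maximum_principle (U V : {poly K}) y (d s B : R) : s < d ->
  (forall z, nrm (z - y) < d -> V.[z] != 0) ->
  (forall z, s < nrm (z - y) -> nrm (z - y) < d -> nrm (U.[z] / V.[z]) <= B) ->
  forall x, nrm (x - y) < d -> nrm (U.[x] / V.[x]) <= B.
Proof.
move=> sd hV hB x xd.
have mm : Num.max s (nrm (x - y)) < d by rewrite gt_max sd.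
have m0 : 0 <= Num.max s (nrm (x - y)) by rewrite le_max norm_ge0 orbT.
have [w [/andP[]]] := value_dense_avoid HK pp
  [seq nrm (b - y) | b <- poly_roots U] m0 mm.
rewrite gt_max => /andP[sw xw] wd hw.
have ew : nrm (w + y - y) = nrm w by rewrite addrK.
have V0 : V != 0.
  by apply: contraTneq (hV x xd) => ->; rewrite horner0 eqxx.
have rV b : b \in poly_roots V -> nrm w < nrm (b - y).
  rewrite mem_poly_roots // => rb; apply: lt_le_trans wd _.
  by rewrite leNgt; apply/negP => /hV; rewrite -rootE rb.
have VE z : nrm (z - y) <= nrm w -> nrm V.[z] = gauss nrm V y (nrm w).
  by move=> hz; apply: (nrm_horner_gauss HK hz) => b /rV; left.
have UE : nrm U.[w + y] = gauss nrm U y (nrm w).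
  apply: (nrm_horner_gauss HK); first by rewrite ew.
  move=> b hb; case: (ltgtP (nrm w) (nrm (b - y))) => h; [by left|by right|].
  by move: hw; rewrite h map_f.
have := hB (w + y); rewrite ew => /(_ sw wd); apply: le_trans.
rewrite !(nrm_div HK) !VE ?ew ?(ltW xw) // UE.
rewrite ler_pM2r; first by apply: (nrm_horner_le_gauss HK); exact: ltW.
by rewrite invr_gt0 (gauss_gt0 HK) //; exact: le_lt_trans xw.
Qed.

(** Dividing by z - y costs at most 2 / d when |z - y| > d / 2; the maximum principle carries the
    bound to the rest of the disc, the diagonal point included. *)
Lemma dq_dist (P1 Q1 P2 Q2 : {poly K}) y (d B : R) : 0 < d ->
  (forall z, nrm (z - y) < d -> Q1.[z] != 0) ->
  (forall z, nrm (z - y) < d -> Q2.[z] != 0) ->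
  (forall z, nrm (z - y) < d ->
     nrm (P1.[z] / Q1.[z] - P2.[z] / Q2.[z]) <= B) ->
  forall x, nrm (x - y) < d -> nrm (dq P1 Q1 y x - dq P2 Q2 y x) <= B / (d / 2).
Proof.
move=> d0 h1 h2 hB x xd.
have yd : nrm (y - y) < d by rewrite subrr (nrm0 HK).
pose V1 := Q1.[y] *: Q1; pose V2 := Q2.[y] *: Q2.
have V1n z : nrm (z - y) < d -> V1.[z] != 0.
  by move=> hz; rewrite hornerZ mulf_neq0 ?h1.
have V2n z : nrm (z - y) < d -> V2.[z] != 0.
  by move=> hz; rewrite hornerZ mulf_neq0 ?h2.
pose U := dq_num P1 Q1 y * V2 - dq_num P2 Q2 y * V1.
have UE z : nrm (z - y) < d -> dq P1 Q1 y z - dq P2 Q2 y z = U.[z] / (V1 * V2).[z].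
  move=> hz; rewrite /dq -/V1 -/V2 /U hornerD hornerN !hornerM; field.
  by rewrite V1n ?V2n.
rewrite UE //; apply: (@maximum_principle U (V1 * V2) y d (d / 2)) => //.
- lra.
- by move=> z hz; rewrite hornerM mulf_neq0 ?V1n ?V2n.
move=> z hz hzd; rewrite -UE // ler_pdivlMr; last by lra.
apply: (@le_trans _ _ (nrm (dq P1 Q1 y z - dq P2 Q2 y z) * nrm (z - y))).
  by rewrite ler_wpM2l // ltW.
rewrite -(Cp_normM HK) mulrBl !dqE ?h1 ?h2 //.
have -> : P1.[z] / Q1.[z] - P1.[y] / Q1.[y] - (P2.[z] / Q2.[z] - P2.[y] / Q2.[y])
  = (P1.[z] / Q1.[z] - P2.[z] / Q2.[z]) - (P1.[y] / Q1.[y] - P2.[y] / Q2.[y]).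
  by ring.
by apply: (nrmB_le HK); exact: hB.
Qed.

(** The second clause transfers the index N of the Cauchy condition to the limit unchanged, so that
    uniformity in a further parameter survives. *)
Lemma uniform_cauchy_approx (A : set K) (P Q : nat -> {poly K}) :
  (forall n z, A z -> (Q n).[z] != 0) ->
  (forall eps, 0 < eps -> exists N, forall n m, (N <= n)%N -> (N <= m)%N ->
     forall z, A z ->
     nrm ((P n).[z] / (Q n).[z] - (P m).[z] / (Q m).[z]) < eps) ->
  exists k, uniform_approx nrm A k P Q /\
    forall eps N, (forall n m, (N <= n)%N -> (N <= m)%N -> forall z, A z ->
      nrm ((P n).[z] / (Q n).[z] - (P m).[z] / (Q m).[z]) < eps) ->
    forall n, (N <= n)%N -> forall z, A z ->
      nrm (k z - (P n).[z] / (Q n).[z]) < eps.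
Proof.
move=> hQ hc; pose q n z := (P n).[z] / (Q n).[z].
have [k hk] : exists k : K -> K, forall z, A z ->
    converges_to nrm (fun n => q n z) (k z).
  have ex z : exists l, A z -> converges_to nrm (fun n => q n z) l.
    have [Az|nAz] := pselect (A z); last by exists 0.
    have [||l _ hl] := Cp_complete HK (u := fun n => q n z); first by [].
      by move=> eps /hc[N hN]; exists N => m n Nm Nn; exact: hN.
    by exists l.
  by have [k hk] := choice ex; exists k.
have unif eps N : (forall n m, (N <= n)%N -> (N <= m)%N -> forall z, A z ->
      nrm (q n z - q m z) < eps) ->
    forall n, (N <= n)%N -> forall z, A z -> nrm (k z - q n z) < eps.
  move=> hN n Nn z Az.
  have e0 : 0 < eps by apply: le_lt_trans (hN n n Nn Nn z Az); exact: norm_ge0.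
  have [M hM] := hk z Az _ e0.
  apply: (nrm_dist_lt_trans HK (y := q (maxn M N) z)).
    by rewrite (nrm_distC HK); apply: hM; exact: leq_maxl.
  by apply: hN => //; exact: leq_maxr.
exists k; split=> //; split=> // eps e0; have [N hN] := hc _ e0.
by exists N => n Nn z Az; exact: unif hN _ Nn _ Az.
Qed.

Variables (A : set K) (f : K -> K) (P Q : nat -> {poly K}) (d : R).
Hypothesis fPQ : uniform_approx nrm A f P Q.
Hypothesis d0 : 0 < d.
Hypothesis Aball : forall y z, A y -> nrm (z - y) < d -> A z.

Lemma dq_dist_domain n m (B : R) :
  (forall z, A z ->
     nrm ((P n).[z] / (Q n).[z] - (P m).[z] / (Q m).[z]) <= B) ->
  forall y x, A y -> A x ->
  nrm (dq (P n) (Q n) y x - dq (P m) (Q m) y x) <= B / (d / 2).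
Proof.
move=> hB y x Ay Ax; have d0' := d0.
have [xd|dx] := ltP (nrm (x - y)) d.
  apply: dq_dist => // z hz.
  - by apply: fPQ.1; exact: Aball hz.
  - by apply: fPQ.1; exact: Aball hz.
  - by apply: hB; exact: Aball hz.
rewrite ler_pdivlMr; last by lra.
set D := dq _ _ _ _ - _.
apply: (@le_trans _ _ (nrm D * nrm (x - y))).
  by rewrite ler_wpM2l //; lra.
rewrite -(Cp_normM HK) mulrBl !dqE ?fPQ.1 //.
set q1 := _ / (Q n).[x]; set q2 := _ / (Q n).[y].
set q3 := _ / (Q m).[x]; set q4 := _ / (Q m).[y].
have -> : q1 - q2 - (q3 - q4) = (q1 - q3) - (q2 - q4) by ring.
by apply: (nrmB_le HK); exact: hB.
Qed.

(** The kernel is the limit of the difference quotients of the approximants, which defines it on the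
    diagonal as well and makes every [kk y] a uniform limit of rational functions. *)
Lemma exists_kernel : exists kk : K -> K -> K,
  [/\ forall y, A y -> uniform_approx nrm A (kk y)
        (fun n => dq_num (P n) (Q n) y) (fun n => (Q n).[y] *: Q n),
      forall y z, A y -> A z -> kk y z * (z - y) = f z - f y &
      forall eps, 0 < eps -> exists N, forall n, (N <= n)%N ->
        forall y z, A y -> A z -> nrm (kk y z - dq (P n) (Q n) y z) < eps].
Proof.
have cau eps : 0 < eps -> exists N, forall n m, (N <= n)%N -> (N <= m)%N ->
    forall y z, A y -> A z ->
    nrm (dq (P n) (Q n) y z - dq (P m) (Q m) y z) < eps.
  move=> e0; have ed : 0 < eps / 2 * (d / 2).
    by apply: mulr_gt0; apply: divr_gt0.
  have [N hN] := fPQ.2 _ ed; exists N => n m Nn Nm y z Ay Az.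
  apply: (@le_lt_trans _ _ (eps / 2 * (d / 2) / (d / 2))); last first.
    by rewrite mulfK ?gt_eqF ?divr_gt0 //; lra.
  apply: dq_dist_domain => // w Aw; apply: (nrm_dist_trans HK (y := f w)).
    by rewrite (nrm_distC HK); exact: ltW (hN _ Nn _ Aw).
  exact: ltW (hN _ Nm _ Aw).
have ex y : exists k, A y -> uniform_approx nrm A k
        (fun n => dq_num (P n) (Q n) y) (fun n => (Q n).[y] *: Q n) /\
    forall eps N, (forall n m, (N <= n)%N -> (N <= m)%N -> forall z, A z ->
      nrm (dq (P n) (Q n) y z - dq (P m) (Q m) y z) < eps) ->
    forall n, (N <= n)%N -> forall z, A z ->
      nrm (k z - dq (P n) (Q n) y z) < eps.
  have [Ay|nAy] := pselect (A y); last by exists id.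
  have [||k hk] := @uniform_cauchy_approx A
      (fun n => dq_num (P n) (Q n) y) (fun n => (Q n).[y] *: Q n).
  - by move=> n z Az; rewrite hornerZ mulf_neq0 // fPQ.1.
  - move=> eps /cau[N hN]; exists N => n m Nn Nm z Az; exact: hN.
  by exists k.
have [kk hkk] := choice ex.
have unif eps : 0 < eps -> exists N, forall n, (N <= n)%N ->
    forall y z, A y -> A z -> nrm (kk y z - dq (P n) (Q n) y z) < eps.
  move=> /cau[N hN]; exists N => n Nn y z Ay Az.
  by apply: (hkk y Ay).2 Nn _ Az => m m' Nm Nm' w Aw; exact: hN.
exists kk; split=> // [y /hkk[]//|y z Ay Az].
apply/eqP; rewrite -subr_eq0 -(nrm_eq0 HK) eq_le norm_ge0 andbT.
rewrite leNgt; apply/negP => eps0.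
set eps := nrm _ in eps0.
(* Adding 1 keeps the denominator positive when [z = y]. *)
have dd : 0 < eps / (nrm (z - y) + 1).
  by rewrite divr_gt0 // ltr_wpDl.
have [N1 hN1] := unif _ dd; have [N2 hN2] := fPQ.2 _ eps0.
pose n := maxn N1 N2.
have n1 : (N1 <= n)%N by exact: leq_maxl.
have n2 : (N2 <= n)%N by exact: leq_maxr.
have hz := hN2 n n2 z Az; have hy := hN2 n n2 y Ay.
have hd : nrm ((kk y z - dq (P n) (Q n) y z) * (z - y)) < eps.
  rewrite (Cp_normM HK).
  apply: (@le_lt_trans _ _ (eps / (nrm (z - y) + 1) * nrm (z - y))).
    by apply: ler_wpM2r => //; exact: ltW (hN1 n n1 y z Ay Az).
  rewrite mulrAC ltr_pdivrMr ?ltr_wpDl // ltr_pM2l // ltrDl; exact: ltr01.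
suff : eps < eps by rewrite ltxx.
rewrite {1}/eps.
have -> : kk y z * (z - y) - (f z - f y) =
  (kk y z - dq (P n) (Q n) y z) * (z - y)
   - ((f z - (P n).[z] / (Q n).[z]) - (f y - (P n).[y] / (Q n).[y])).
  by rewrite [X in _ = X - _]mulrBl dqE ?fPQ.1 //; ring.
by apply: (nrmB_lt HK) => //; exact: (nrmB_lt HK).
Qed.

End DifferenceQuotient.

(** * Functions with small derivative *)

Section PolynomialApproximation.
Variables (R : realType) (p : nat) (K : closedFieldType) (nrm : K -> R).
Hypothesis HK : is_Cp p nrm.
Hypothesis pp : prime p.
Let norm_ge0 := Cp_norm_ge0 HK.

(** Each factor has relative variation at most t / d, and ultrametric errors do not add up. *)
Lemma prod_roots_near (s : seq K) x y (d t : R) : 0 < d -> 0 <= t -> t <= d ->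
  nrm (x - y) <= t -> (forall b, b \in s -> d <= nrm (y - b)) ->
  nrm (\prod_(b <- s) (x - b) - \prod_(b <- s) (y - b))
    <= t / d * nrm (\prod_(b <- s) (y - b)).
Proof.
move=> d0 t0 td xt; elim: s => [|b s IH] hs.
  by rewrite !big_nil subrr (nrm0 HK) mulr_ge0 // divr_ge0 // ltW.
have {}IH := IH (fun c hc => hs c (mem_behead (s := b :: s) hc)).
have yb := hs b (mem_head _ _).
rewrite !big_cons; set X := \prod_(_ <- _) _ in IH *.
set Y := \prod_(_ <- _) _ in IH *.
have -> : (x - b) * X - (y - b) * Y = (x - b) * (X - Y) + (x - y) * Y by ring.
rewrite (Cp_normM HK (y - b) Y).
have xb : nrm (x - b) <= nrm (y - b).
  apply: (nrm_dist_trans HK) (lexx _); apply: le_trans xt _.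
  exact: le_trans yb.
apply: (nrmD_le HK); rewrite (Cp_normM HK).
  apply: (@le_trans _ _ (nrm (y - b) * (t / d * nrm Y))).
    exact: ler_pM.
  by rewrite mulrCA.
rewrite mulrA; apply: ler_wpM2r => //; apply: le_trans xt _.
by rewrite mulrAC ler_pdivlMr // ler_wpM2l.
Qed.

Lemma den_near_center (Q : {poly K}) x y (d t : R) : 0 < d -> 0 <= t -> t <= d ->
  (forall z, nrm (z - y) < d -> Q.[z] != 0) ->
  nrm (x - y) <= t -> nrm (Q.[x] - Q.[y]) <= t / d * nrm Q.[y].
Proof.
move=> d0 t0 td hQ xt.
have Q0 : Q != 0.
  by apply: contraTneq (hQ y _) => [->|]; rewrite ?horner0 ?eqxx // subrr (nrm0 HK).
have QE z : Q.[z] = lead_coef Q * \prod_(b <- poly_roots Q) (z - b).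
  rewrite {1}(poly_rootsE Q) hornerZ horner_prod; congr (_ * _).
  by apply: eq_bigr => b _; rewrite !hornerE.
rewrite !QE -mulrBr !(Cp_normM HK) mulrCA; apply: ler_wpM2l => //.
apply: prod_roots_near => // b; rewrite mem_poly_roots // => rb.
rewrite (nrm_distC HK) leNgt; apply/negP => /hQ.
by rewrite -rootE rb.
Qed.

(** Replaces a quotient by a polynomial, whose coefficients can be compared with those of its
    derivative. *)
Lemma polynomial_approx (P Q : {poly K}) y (d t eps : R) :
  0 < t -> t < d -> 0 < eps ->
  (forall z, nrm (z - y) < d -> Q.[z] != 0) ->
  exists G : {poly K}, forall x, nrm (x - y) <= t ->
    nrm (P.[x] / Q.[x] - G.[x]) <= eps.
Proof.
move=> t0 td e0 hQ.
have d0 : 0 < d by exact: lt_trans td.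
have Qy : Q.[y] != 0 by apply: hQ; rewrite subrr (nrm0 HK).
have Qy0 : 0 < nrm Q.[y] by rewrite (nrm_gt0 HK).
pose M := gauss nrm P y t / nrm Q.[y].
have M0 : 0 <= M by rewrite divr_ge0 // (gauss_ge0 HK).
have M1 : 0 < M + 1 by lra.
have th0 : 0 <= t / d by rewrite divr_ge0 // ltW.
have th1 : t / d < 1 by rewrite ltr_pdivrMr // mul1r.
have [N hN] := expr_small th0 th1 (divr_gt0 e0 M1).
have {hN} hN := hN N (leqnn N).
(* The geometric series expansion of 1 / Q around the constant Q(y). *)
have [u uE] : exists u : {poly K}, forall x, u.[x] = 1 - Q.[x] / Q.[y].
  by exists (1 - Q.[y]^-1 *: Q) => x; rewrite !hornerE mulrC.
exists (P * (Q.[y]^-1 *: \sum_(i < N) u ^+ i)) => x hx.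
have Qx : Q.[x] != 0 by apply: hQ; exact: le_lt_trans td.
have nu : nrm u.[x] <= t / d.
  have -> : u.[x] = - ((Q.[x] - Q.[y]) / Q.[y]) by rewrite uE; field.
  rewrite (nrmN HK) (nrm_div HK) ler_pdivrMr //.
  by apply: den_near_center => //; exact: ltW.
have geo : Q.[x] / Q.[y] * (\sum_(i < N) u ^+ i).[x] = 1 - u.[x] ^+ N.
  have -> : Q.[x] / Q.[y] = 1 - u.[x] by rewrite uE; ring.
  have := congr1 (fun W => W.[x]) (subrX1 u N).
  rewrite /= hornerM !hornerD hornerN horner_exp hornerC => h.
  by rewrite -[RHS]opprB h; ring.
have -> : P.[x] / Q.[x] - (P * (Q.[y]^-1 *: \sum_(i < N) u ^+ i)).[x] =
    P.[x] / Q.[x] * u.[x] ^+ N.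
  rewrite hornerM hornerZ -[u.[x] ^+ N](subKr 1) -geo; field.
  by rewrite Qx Qy.
have PQ : nrm (P.[x] / Q.[x]) <= M.
  have -> : nrm (P.[x] / Q.[x]) = nrm P.[x] / nrm Q.[y].
    rewrite (nrm_div HK); congr (_ / _); apply: (nrm_dominant HK).
    apply: le_lt_trans (den_near_center d0 (ltW t0) (ltW td) hQ hx) _.
    by rewrite -[ltRHS]mul1r ltr_pM2r.
  by rewrite ler_pM2r ?invr_gt0 // (nrm_horner_le_gauss HK).
rewrite (Cp_normM HK) (nrmX HK).
apply: (@le_trans _ _ (M * (t / d) ^+ N)).
  by apply: ler_pM => //; [rewrite exprn_ge0|apply: lerXn2r; rewrite ?nnegrE].
move: hN; rewrite ltr_pdivlMr // => hN.
have : 0 <= (t / d) ^+ N by exact: exprn_ge0.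
lra.
Qed.

(** Cauchy's estimate for coefficients, by induction on the roots. *)
Lemma coef_le_gauss (P : {poly K}) (rho : R) j : 0 <= rho ->
  nrm P`_j * rho ^+ j <= gauss nrm P 0 rho.
Proof.
move=> r0; rewrite {1}(poly_rootsE P) coefZ (Cp_normM HK) -mulrA.
apply: ler_wpM2l => //.
elim: (poly_roots P) j => [|b s IH] j.
  rewrite !big_nil coef1; case: j => [|j]; first by rewrite (nrm1 HK) mulr1.
  by rewrite (nrm0 HK) mul0r.
rewrite !big_cons mulrBl coefB coefXM coefCM.
set W := \prod_(_ <- _) (_ - _) in IH *.
set G := \prod_(c <- s) Num.max rho (nrm (c - 0)) in IH *.
have G0 : 0 <= G by apply: prodr_ge0 => c _; rewrite le_max r0.
have hb : nrm (b - 0) = nrm b by rewrite subr0.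
case: j => [|j] /=.
  rewrite sub0r (nrmN HK) (Cp_normM HK) -mulrA; apply: ler_pM => //.
  - by rewrite mulr_ge0.
  - by rewrite le_max hb lexx orbT.
have h1 : nrm W`_j * rho ^+ j.+1 <= Num.max rho (nrm (b - 0)) * G.
  rewrite exprS mulrCA; apply: ler_pM => //; first by rewrite mulr_ge0 ?exprn_ge0.
  by rewrite le_max lexx.
have h2 : nrm (b * W`_j.+1) * rho ^+ j.+1 <= Num.max rho (nrm (b - 0)) * G.
  rewrite (Cp_normM HK) -mulrA; apply: ler_pM => //.
    by rewrite mulr_ge0 ?exprn_ge0.
  by rewrite le_max hb lexx orbT.
have r1 : 0 <= rho ^+ j.+1 by exact: exprn_ge0.
apply: le_trans (ler_wpM2r r1 (Cp_normD HK _ _)) _; rewrite (nrmN HK).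
by case: (leP (nrm W`_j)).
Qed.

(** Cauchy's estimate for the derivative at a radius |w| between s / 2 and s bounds its
    coefficients. Those of G around y are their quotients by integers i + 1, and the factor |p| on
    the radius pays for these divisions. *)
Lemma small_derivative (G : {poly K}) y (s eta : R) : 0 < s -> 0 <= eta ->
  (forall z, nrm (z - y) < s -> nrm G^`().[z] <= eta) ->
  forall x, nrm (x - y) <= nrm p%:R * (s / 2) -> nrm (G.[x] - G.[y]) <= eta * s.
Proof.
move=> s0 eta0 hG x hx.
pose F := G \Po ('X + y%:P).
have FE z : F.[z] = G.[z + y] by rewrite horner_comp !hornerE.
have F'E z : F^`().[z] = G^`().[z + y].
  by rewrite deriv_comp derivD derivX derivC addr0 mulr1 horner_comp !hornerE.
have sh : s / 2 < s by lra.
have sh0 : 0 <= s / 2 by lra.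
have [w [/andP[w1 w2] hw]] := value_dense_avoid HK pp
  [seq nrm (b - 0) | b <- poly_roots F^`()] sh0 sh.
have gle : gauss nrm F^`() 0 (nrm w) <= eta.
  rewrite -(@nrm_horner_gauss _ _ _ _ HK F^`() 0 (nrm w) w).
  - by rewrite F'E; apply: hG; rewrite addrK.
  - by rewrite subr0.
  - move=> b hb; rewrite (subr0 w).
    case: (ltgtP (nrm w) (nrm (b - 0))) => h; [by left|by right|].
    by move: hw; rewrite h map_f.
have w0 : 0 < nrm w by lra.
pose t := x - y.
have -> : G.[x] = F.[t] by rewrite FE subrK.
have -> : G.[y] = F.[0] by rewrite FE add0r.
have sz : (size F <= (size F).+1)%N by [].
rewrite (horner_coef_wide t sz) big_ord_recl horner_coef0 expr0 mulr1 addrC addKr.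
apply: (nrm_sum_le HK) => [|i]; first by rewrite mulr_ge0 // ltW.
rewrite /= /bump add1n (Cp_normM HK) (nrmX HK).
have c0 := coef_le_gauss F^`() i (ltW w0).
have ti : nrm t ^+ i.+1 <= nrm p%:R ^+ i.+1 * nrm w ^+ i.+1.
  rewrite -exprMn; apply: lerXn2r; rewrite ?nnegrE ?mulr_ge0 //.
  apply: le_trans hx _; apply: ler_wpM2l => //; exact: ltW.
apply: (@le_trans _ _ (nrm F`_i.+1 * (nrm i.+1%:R * nrm w ^+ i.+1))).
  apply: ler_wpM2l => //; apply: le_trans ti _.
  apply: ler_wpM2r; first by rewrite exprn_ge0.
  exact: nrm_natr_ge.
have -> : nrm F`_i.+1 * (nrm i.+1%:R * nrm w ^+ i.+1) =
    nrm F^`()`_i * nrm w ^+ i * nrm w.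
  by rewrite coef_deriv -(mulr_natr F`_i.+1) (Cp_normM HK F`_i.+1) exprSr !mulrA.
apply: ler_pM => //; last by exact: ltW.
  by rewrite mulr_ge0 ?exprn_ge0.
exact: le_trans gle.
Qed.

Lemma small_derivative_quot (P Q : {poly K}) y (d eta : R) :
  0 < d -> 0 < eta ->
  (forall z, nrm (z - y) < d -> Q.[z] != 0) ->
  (forall z, nrm (z - y) < d -> nrm (dq P Q z z) <= eta) ->
  forall x, nrm (x - y) <= nrm p%:R * (d / 4) ->
  nrm (P.[x] / Q.[x] - P.[y] / Q.[y]) <= eta * d.
Proof.
move=> d0 eta0 hQ hdq x hx.
have s0 : 0 < d / 2 by lra.
have sd : d / 2 < d by lra.
(* This is the accuracy that [dq_dist], on the disc of radius [d / 2], turns into a distance [eta]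
   between the diagonal quotients. *)
have e0 : 0 < eta * (d / 2 / 2) by rewrite mulr_gt0 //; lra.
have [G hG] := polynomial_approx P s0 sd e0 hQ.
have G' z : nrm (z - y) < d / 2 -> nrm G^`().[z] <= eta.
  move=> hz; have ball w : nrm (w - z) < d / 2 -> nrm (w - y) < d / 2.
    by move=> hw; exact: (nrm_dist_lt_trans HK hw hz).
  have QG : nrm (dq P Q z z - dq G 1 z z) <= eta * (d / 2 / 2) / (d / 2 / 2).
    apply: (dq_dist HK pp s0) => [w /ball hw|w _|w /ball hw|].
    - by apply: hQ; exact: lt_trans sd.
    - by rewrite hornerC oner_neq0.
    - by rewrite hornerC divr1; apply: hG; exact: ltW.
    - by rewrite subrr (nrm0 HK).
  rewrite mulfK in QG; last by rewrite gt_eqF //; lra.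
  rewrite -dq_diag -[dq G 1 z z](subKr (dq P Q z z)).
  by apply: (nrmB_le HK) => //; apply: hdq; exact: lt_trans sd.
have p1 := nrm_p_lt1 HK pp; have p0 := nrm_p_gt0 HK pp.
have hx2 : nrm (x - y) <= nrm p%:R * (d / 2 / 2).
  by apply: le_trans hx _; rewrite ler_pM2l //; lra.
have hGxy := small_derivative s0 (ltW eta0) G' hx2.
have xd : nrm (x - y) <= d / 2.
  apply: le_trans hx2 _; apply: (@le_trans _ _ (1 * (d / 2 / 2))); last by lra.
  by apply: ler_wpM2r; [lra|exact: ltW].
have hx3 := hG x xd.
have hy3 : nrm (P.[y] / Q.[y] - G.[y]) <= eta * (d / 2 / 2).
  by apply: hG; rewrite subrr (nrm0 HK) ltW.
have l1 : eta * (d / 2 / 2) <= eta * d by rewrite ler_pM2l //; lra.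
have l2 : eta * (d / 2) <= eta * d by rewrite ler_pM2l //; lra.
have -> : P.[x] / Q.[x] - P.[y] / Q.[y] = (P.[x] / Q.[x] - G.[x]) +
   (G.[x] - G.[y]) - (P.[y] / Q.[y] - G.[y]) by ring.
apply: (nrmB_le HK); last exact: le_trans l1.
by apply: (nrmD_le HK); [exact: le_trans l1|exact: le_trans l2].
Qed.

End PolynomialApproximation.

(** * The kernel has no zero *)

Lemma gap_nil (R : realType) (x y : R) : gap [::] x y.
Proof. by move=> s; rewrite in_nil. Qed.

Section KernelNonzero.
Variables (R : realType) (p : nat) (K : closedFieldType) (nrm : K -> R).
Hypothesis HK : is_Cp p nrm.
Hypothesis pp : prime p.
Let norm_ge0 := Cp_norm_ge0 HK.

(** The monomial law holds on the punctured disc, and continuity at the centre, where the value is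
    not 0, forces the exponent to be 0. *)
Lemma zero_free_disc (A : set K) k P Q e (r : R) :
  uniform_approx nrm A k P Q -> radial_domain nrm A e r [::] ->
  (forall z, nrm (z - e) < r -> k z != 0) ->
  forall z, nrm (z - e) < r -> nrm (k z) = nrm (k e).
Proof.
move=> kPQ Aer kz; have [_ r0 _] := Aer.
have kz' z : 0 < nrm (z - e) < r -> k z != 0 by move=> /andP[_]; exact: kz.
have [C [m [C0 hC hk]]] := annulus_monomial HK pp kPQ Aer (lexx 0) (lexx r)
  (gap_nil 0 r) kz' r0.
set H := radial_norm nrm P Q e r in hC hk.
have cH : continuous H := continuous_radial_norm HK pp kPQ Aer.
have H0 : H 0 = nrm (k e) := radial_norm_center HK kPQ Aer.
have ke0 : 0 < nrm (k e) by rewrite (nrm_gt0 HK) kz // subrr (nrm0 HK).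
(* Near 0 the radial norm stays between 1/2 and 3/2 of [nrm (k e)], a ratio below 3, whereas passing
   from [t] to [t / 5] with a nonzero exponent changes it by a factor at least 5. *)
have m0 : m = 0.
  have e0 : 0 < nrm (k e) / 2 by lra.
  have /cvgrPdist_lt /(_ _ e0) /nbhs_ballP [d /= d0 hd] := cH 0.
  pose t := Num.min d r / 2.
  have t0 : 0 < t by rewrite divr_gt0 // lt_min d0.
  have td : t < d.
    have : Num.min d r <= d by rewrite ge_min lexx.
    rewrite /t; lra.
  have tr : t < r.
    have : Num.min d r <= r by rewrite ge_min lexx orbT.
    rewrite /t; lra.
  have near u : 0 < u -> u <= t -> nrm (k e) / 2 < C * u ^ m < 3 * (nrm (k e) / 2).
    move=> u0 ut; have ur : 0 < u < r by rewrite u0 (le_lt_trans ut).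
    have hu : ball 0 d u by rewrite /ball /= sub0r normrN gtr0_norm //; lra.
    have := hd _ hu; rewrite /= H0 hC // ltr_norml => /andP[h1 h2].
    apply/andP; split; lra.
  have /andP[a1 a2] := near t t0 (lexx t).
  have t5 : 0 < t / 5 by lra.
  have t5t : t / 5 <= t by lra.
  have /andP[] := near _ t5 t5t.
  have -> : C * (t / 5) ^ m = C * t ^ m / 5 ^ m.
    by rewrite expfzMl exprz_inv -invr_expz mulrA.
  have [//|mn] := eqVneq m 0.
  have h5 n : 5 <= (5 : R) ^ n.+1%:Z.
    by rewrite -exprnP exprS ler_peMr //; apply: exprn_ege1; lra.
  move: a1 a2; set q := C * t ^ m => a1 a2.
  have hq : 0 < nrm (k e) / 2 by [].
  move=> b1 b2; exfalso.
  have [n [mE|mE]] : exists n, m = n.+1%:Z \/ m = - n.+1%:Z.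
    case: (m) mn => [[|n]|n] // _; first by exists n; left.
    by exists n; right.
  - rewrite mE in b1; have := h5 n; set F := _ ^ _ in b1 * => F5.
    move: b1; rewrite ltr_pdivlMr; last by lra.
    have := ler_wpM2l (ltW hq) F5; lra.
  - rewrite mE -invr_expz invrK in b2.
    have q0 : 0 <= q by lra.
    have := ler_wpM2l q0 (h5 n); lra.
have HC t : 0 < t < r -> H t = C by move=> /hC; rewrite m0 expr0z mulr1.
have [HC0 _] := constant_closure HK pp (lexx 0) r0 cH HC.
move=> z hz; have [ze|ze] := eqVneq z e; first by rewrite ze.
have zr : 0 < nrm (z - e) < r by rewrite hz (nrm_gt0 HK) subr_eq0 ze.
by rewrite hk // HC // -H0 HC0.
Qed.

Variables (A : set K) (f : K -> K) (P Q : nat -> {poly K}) (d : R).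
Hypothesis fPQ : uniform_approx nrm A f P Q.
Hypothesis d0 : 0 < d.
Hypothesis Aball : forall y z, A y -> nrm (z - y) < d -> A z.
Hypothesis finj : forall y z, A y -> A z -> f y = f z -> y = z.
Variable kk : K -> K -> K.
Hypothesis kkPQ : forall y, A y -> uniform_approx nrm A (kk y)
        (fun n => dq_num (P n) (Q n) y) (fun n => (Q n).[y] *: Q n).
Hypothesis kkE : forall y z, A y -> A z -> kk y z * (z - y) = f z - f y.
Hypothesis kk_unif : forall eps, 0 < eps -> exists N, forall n, (N <= n)%N ->
        forall y z, A y -> A z -> nrm (kk y z - dq (P n) (Q n) y z) < eps.

Lemma kernel_offdiag_neq0 y z : A y -> A z -> y != z -> kk y z != 0.
Proof.
move=> Ay Az yz; apply: contraNneq yz => k0; apply/eqP/finj => //.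
by apply/esym/eqP; rewrite -subr_eq0 -kkE // k0 mul0r.
Qed.

Lemma disc_radial_domain y (r : R) : A y -> 0 < r -> r < d ->
  radial_domain nrm A y r [::].
Proof.
move=> Ay r0 rd; split=> // x xr _.
by apply: Aball Ay _; exact: le_lt_trans rd.
Qed.

(** [kk y'] has constant absolute value c on its disc, so f scales distances from y' by c. For s <
    |z - y| < r the isosceles principle gives |f z - f y| = c |z - y|, so the monomial of [kk y] is
    the constant c, up to the centre y. *)
Lemma kernel_diag_neq0_near y y' : A y -> nrm (y' - y) < d ->
  kk y' y' != 0 -> kk y y != 0.
Proof.
move=> Ay yd k'; have Ay' := Aball Ay yd.
have [yy|yy] := eqVneq y' y; first by rewrite -yy.
have d0' := d0.
(* [r < d] because radial domains require a closed disc, while [Aball] only provides the open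
   one. *)
pose s := nrm (y' - y); pose r := (s + d) / 2.
have s0 : 0 < s by rewrite (nrm_gt0 HK) subr_eq0.
have sr : s < r by rewrite /r -/s in yd *; lra.
have rd : r < d by rewrite /r -/s in yd *; lra.
have r0 : 0 < r by lra.
have D := disc_radial_domain Ay r0 rd; have D' := disc_radial_domain Ay' r0 rd.
have AD z : nrm (z - y) < r -> A z.
  by move=> h; apply: Aball Ay _; exact: lt_trans rd.
have AD' z : nrm (z - y') < r -> A z.
  by move=> h; apply: Aball Ay' _; exact: lt_trans rd.
have n' z : nrm (z - y') < r -> kk y' z != 0.
  move=> h; have [<-//|hz] := eqVneq y' z.
  by apply: kernel_offdiag_neq0 => //; exact: AD'.
have cst := zero_free_disc (kkPQ Ay') D' n'.
set c := nrm (kk y' y') in cst.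
have c0 : 0 < c by rewrite (nrm_gt0 HK).
have outer z : s < nrm (z - y) -> nrm (z - y) < r -> nrm (kk y z) = c.
  move=> sz zr; have zy : nrm (z - y) != 0 by rewrite gt_eqF //; lra.
  have zy' : nrm (z - y') = nrm (z - y).
    apply: (nrm_dominant HK); have -> : z - y' - (z - y) = y - y' by ring.
    by rewrite (nrm_distC HK y y').
  have Az := AD z zr.
  apply: (mulIf zy); rewrite -(Cp_normM HK) kkE // -zy'.
  have -> : c * nrm (z - y') = nrm (f z - f y').
    by rewrite -kkE // (Cp_normM HK) cst // zy'.
  apply/esym/(nrm_dominantr HK).
  have -> : f z - f y' - (f z - f y) = f y - f y' by ring.
  rewrite -!kkE // !(Cp_normM HK) !cst ?zy' //; last by rewrite (nrm_distC HK y y').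
  by rewrite ltr_pM2l // (nrm_distC HK y y').
have kn z : 0 < nrm (z - y) < r -> kk y z != 0.
  move=> /andP[z0 zr]; apply: kernel_offdiag_neq0 => //; first exact: AD.
  by apply: contraTneq z0 => ->; rewrite subrr (nrm0 HK) ltxx.
have [C [m [C0 hC hk]]] := annulus_monomial HK pp (kkPQ Ay) D (lexx 0) (lexx r)
  (gap_nil 0 r) kn r0.
have eqc z : s < nrm z -> nrm z < r -> C * nrm z ^ m = c * nrm z ^ 0.
  move=> sz zr; have ez : nrm (z + y - y) = nrm z by rewrite addrK.
  have zr' : 0 < nrm (z + y - y) < r by rewrite ez zr (lt_trans s0).
  by rewrite expr0z mulr1 -(outer (z + y)) ?ez // hk // hC // ez.
have [z1 /andP[sz1 z1r]] := value_dense HK pp (ltW s0) sr.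
have [z2 /andP[z12 z2r]] := value_dense HK pp (norm_ge0 z1) z1r.
have z10 : 0 < nrm z1 by lra.
have [||_ m0] := @monomial_inj _ C c (nrm z1) (nrm z2) m 0 C0 c0 z10 z12.
- exact: eqc.
- by apply: eqc => //; lra.
have HC t : 0 < t < r -> radial_norm nrm (fun n => dq_num (P n) (Q n) y)
    (fun n => (Q n).[y] *: Q n) y r t = C.
  by move=> /hC ->; rewrite m0 expr0z mulr1.
have cH := continuous_radial_norm HK pp (kkPQ Ay) D.
have [HC0 _] := constant_closure HK pp (lexx 0) r0 cH HC.
rewrite -(nrm_gt0 HK) -(radial_norm_center HK (kkPQ Ay) D) HC0.
exact: C0.
Qed.

(** By the previous lemma a zero at (y, y) spreads to the diagonal over a whole disc. The
    approximants then have small derivative there, so f would vary near y by less than |f(w + y) -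
    f(y)|, which injectivity makes nonzero. *)
Lemma kernel_neq0 y z : A y -> A z -> kk y z != 0.
Proof.
move=> Ay Az; have [<-{z Az}|yz] := eqVneq y z; last exact: kernel_offdiag_neq0.
have d0' := d0.
apply/negP => /eqP ky.
have kD w : nrm (w - y) < d -> kk w w = 0.
  move=> hw; apply/eqP; apply: contraT => kw.
  by have := kernel_diag_neq0_near Ay hw kw; rewrite ky eqxx.
have p0 := nrm_p_gt0 HK pp; have p1 := nrm_p_lt1 HK pp.
have b0 : 0 < nrm p%:R * (d / 4) by rewrite mulr_gt0 //; lra.
have [w /andP[w0 wb]] := value_dense HK pp (lexx 0) b0.
have ew : nrm (w + y - y) = nrm w by rewrite addrK.
have wd : nrm (w + y - y) < d.
  rewrite ew; apply: lt_trans wb _; apply: (@lt_trans _ _ (1 * (d / 4))); last by lra.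
  by rewrite ltr_pM2r //; lra.
have Aw := Aball Ay wd.
have fne : f (w + y) - f y != 0.
  rewrite subr_eq0; apply: contraTneq w0 => /(finj Aw Ay) h.
  by rewrite -ew h subrr (nrm0 HK) ltxx.
set eps := nrm (f (w + y) - f y).
have eps0 : 0 < eps by rewrite (nrm_gt0 HK).
(* [small_derivative_quot] yields the bound [eta * d], here [eps / 2]. *)
have eta0 : 0 < eps / 2 / d by rewrite divr_gt0 //; lra.
have [N1 hN1] := kk_unif eta0; have [N2 hN2] := fPQ.2 _ eps0.
pose n := maxn N1 N2.
have n1 : (N1 <= n)%N by exact: leq_maxl.
have n2 : (N2 <= n)%N by exact: leq_maxr.
have hQ u : nrm (u - y) < d -> (Q n).[u] != 0.
  by move=> hu; apply: fPQ.1; exact: Aball Ay hu.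
have hdq u : nrm (u - y) < d -> nrm (dq (P n) (Q n) u u) <= eps / 2 / d.
  move=> hu; have Au := Aball Ay hu.
  by have := ltW (hN1 n n1 u u Au Au); rewrite kD // sub0r (nrmN HK).
have wb' : nrm (w + y - y) <= nrm p%:R * (d / 4) by rewrite ew ltW.
have := small_derivative_quot HK pp d0 eta0 hQ hdq wb'.
rewrite divfK ?gt_eqF // => hs.
have hs' : nrm ((P n).[w + y] / (Q n).[w + y] - (P n).[y] / (Q n).[y]) < eps.
  by apply: le_lt_trans hs _; lra.
suff : eps < eps by rewrite ltxx.
rewrite {1}/eps.
have -> : f (w + y) - f y = (f (w + y) - (P n).[w + y] / (Q n).[w + y])
   - ((f y - (P n).[y] / (Q n).[y])
     - ((P n).[w + y] / (Q n).[w + y] - (P n).[y] / (Q n).[y])) by ring.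
by apply: (nrmB_lt HK); [exact: hN2|apply: (nrmB_lt HK) => //; exact: hN2].
Qed.

Lemma kernelC y z : A y -> A z -> kk y z = kk z y.
Proof.
move=> Ay Az; have [->//|yz] := eqVneq y z.
apply: (mulIf (x := z - y)); first by rewrite subr_eq0 eq_sym.
by rewrite kkE // -[in RHS](opprB y z) mulrN kkE // opprB.
Qed.

End KernelNonzero.

(** * Discs and circles in affinoids *)

Section Affinoid.
Variables (R : realType) (p : nat) (K : closedFieldType) (nrm : K -> R).
Hypothesis HK : is_Cp p nrm.

Lemma value_group_gt0 r : value_group nrm r -> 0 < r.
Proof. by move=> [z /= z0 <-]; rewrite (nrm_gt0 HK). Qed.

(** A hole does not contain e, so all its points are as far from e as its centre: it meets only one
    circle around e. *)
Lemma affinoid_radial_domain A a b e : is_affinoid nrm A ->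
  A a -> A b -> A e -> a != b ->
  exists S, radial_domain nrm A e (nrm (a - b)) S.
Proof.
move=> [B [n [U [[a0 [r0 [_ ->]]] hU ->]]]] [Ba _] [Bb _] [Be nUe] ab.
have [c hc] := choice hU.
exists [seq nrm (c i - e) | i <- enum 'I_n]; split=> //.
  by rewrite (nrm_gt0 HK) subr_eq0.
move=> x hx hS; split=> /=.
  apply: (nrm_dist_trans HK (y := e)) => //; apply: le_trans hx _.
  by apply: (nrm_dist_trans HK Ba); rewrite (nrm_distC HK).
move=> [i _ Ui]; move/negP: hS; apply.
have [r [_ UE]] := hc i; move: Ui; rewrite UE /= => xr.
have er : r <= nrm (e - c i).
  rewrite leNgt; apply/negP => er; apply: nUe; exists i => //.
  by rewrite UE.
have -> : nrm (x - e) = nrm (c i - e).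
  rewrite (nrm_distC HK x); rewrite (nrm_distC HK (c i)); apply: (nrm_dominant HK).
  have -> : e - x - (e - c i) = - (x - c i) by ring.
  by rewrite (nrmN HK); exact: lt_le_trans er.
by rewrite map_f // mem_enum.
Qed.

(** With d the smallest radius involved, a move by less than d neither leaves the closed ball nor
    enters a hole. *)
Lemma affinoid_ball A : is_affinoid nrm A ->
  exists2 d, 0 < d & forall y z, A y -> nrm (z - y) < d -> A z.
Proof.
move=> [B [n [U [[a0 [r0 [/value_group_gt0 r0p ->]]] hU ->]]]].
have [c hc] := choice hU; have [r hr] := choice hc.
exists (\big[Num.min/r0]_(i < n) r i).
  apply/bigmin_gtP; split=> // i _.
  by case: (hr i) => /value_group_gt0.
move=> y z [By nUy] hz; split=> /=.
  apply: (nrm_dist_trans HK (y := y)) => //.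
  by apply: ltW; apply: lt_le_trans hz _; exact: bigmin_le_id.
move=> [i _ Ui]; apply: nUy; exists i => //.
have [_ UE] := hr i; move: Ui; rewrite UE /= => zr.
apply: (nrm_dist_lt_trans HK (y := z)) => //.
rewrite (nrm_distC HK); apply: lt_le_trans hz _.
exact: bigmin_le.
Qed.

End Affinoid.

(** * Invariance of the cross-ratio *)

Theorem mainTheorem3 (R : realType) (p : nat) (K : closedFieldType)
    (nrm : K -> R) (X : set K) (f : K -> K) :
  prime p ->
  is_Cp p nrm ->
  is_analytic_space nrm X ->
  holomorphic_on nrm X f ->
  (forall x y : K, X x -> X y -> f x = f y -> x = y) ->
  forall a b c d : K, X a -> X b -> X c -> X d ->
    uniq [:: a; b; c; d] ->
    cross_ratio_defined (f a) (f b) (f c) (f d) /\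
    nrm (cross_ratio a b c d) = nrm (cross_ratio (f a) (f b) (f c) (f d)).
Proof.
move=> pp HK [An [hAn incr XE]] hol inj a b c d Xa Xb Xc Xd hu.
have defd : cross_ratio_defined (f a) (f b) (f c) (f d).
  rewrite /cross_ratio_defined.
  have -> : [:: f a; f b; f c; f d] = map f [:: a; b; c; d] by [].
  rewrite map_inj_in_uniq // => x y; rewrite !inE => hx hy; apply: inj.
    by move: hx => /or4P[] /eqP->.
  by move: hy => /or4P[] /eqP->.
split=> //.
have mono i j : (i <= j)%N -> An i `<=` An j.
  move=> /subnKC <-; elim: (j - i)%N => [|m IH]; first by rewrite addn0.
  by rewrite addnS; apply: subset_trans IH _; exact: incr.
rewrite XE in Xa Xb Xc Xd.
move: Xa Xb Xc Xd => [na _ Xa] [nb _ Xb] [nc _ Xc] [nd _ Xd].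
pose N := maxn (maxn na nb) (maxn nc nd); pose A := An N.
have AX : A `<=` X by rewrite XE => x Ax; exists N.
have Aa : A a by apply: mono Xa; rewrite !leq_max leqnn.
have Ab : A b by apply: mono Xb; rewrite !leq_max leqnn orbT.
have Ac : A c by apply: mono Xc; rewrite !leq_max leqnn !orbT.
have Ad : A d by apply: mono Xd; rewrite !leq_max leqnn !orbT.
have [P [Q fPQ]] := hol A (hAn N) AX.
have fPQ' : uniform_approx nrm A f P Q by [].
have finj y z : A y -> A z -> f y = f z -> y = z.
  by move=> /AX Xy /AX Xz; exact: inj.
have [dl dl0 Aball] := affinoid_ball HK (hAn N).
have [kk [kkPQ kkE kku]] := exists_kernel HK pp fPQ' dl0 Aball.
have kk0 := kernel_neq0 HK pp fPQ' dl0 Aball finj kkPQ kkE kku.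
have kkC := kernelC kkE.
have dom u v e : A u -> A v -> A e -> u != v ->
    exists S, radial_domain nrm A e (nrm (u - v)) S.
  by move=> Au Av Ae; exact: (affinoid_radial_domain HK (hAn N)).
have := symmetric_kernel_quotient HK pp kkPQ kk0 kkC dom Aa Ab Ac Ad.
have nz u v : A u -> A v -> nrm (kk u v) != 0.
  by move=> Au Av; rewrite (nrm_eq0 HK) kk0.
move=> /eqP; rewrite eqr_div ?nz // => /eqP hq.
rewrite /cross_ratio -!kkE //.
(* The cross-ratio of the images is that of the points times a quotient of kernel values, whose norm
   is 1 by [hq]. *)
have -> : kk c a * (a - c) * (kk d b * (b - d)) / (kk d a * (a - d) * (kk c b * (b - c)))
  = (kk c a * kk d b) / (kk c b * kk d a) *
    ((a - c) * (b - d) / ((a - d) * (b - c))).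
  by rewrite mulf_div; congr (_ / _); ring.
rewrite [RHS](Cp_normM HK) (nrm_div HK (_ * kk d b)) !(Cp_normM HK (kk _ _)) hq.
by rewrite divff ?mul1r // mulf_neq0 ?nz.
Qed.
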